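(* The theory $\mathcal{T_M}^+$ (defined in the context) proves the following mathematical statement. Let $U$ be a map from $X$ to $X$, $\varphi$ a map from $X\times X$ to $\mathbb{R}$, and $(u_n)_{n\in\mathbb{N}}$ a sequence of elements of $X$ such that $\lim_nd(U(u_n),u_n)=0$. Consider $F:=Fix(U)$. If $$\forall k\in\mathbb{N}\,\exists x\in F\,\forall y\in F\left(\varphi(x,x)<\varphi(x,y)+\frac{1}{k+1}\right)$$ then $$\forall k\in\mathbb{N}\,\exists x\in F\,\exists n\in\mathbb{N}\,\forall m\geq n\left(\varphi(x,x)<\varphi(x,u_m)+\frac{1}{k+1}\right).$$
   Context: **The theory $\mathcal{T_M}$** (bounded metric spaces). Language: finite types over base types $0$ (natural numbers) and $X$ (abstract metric space); $1:=0\to0$; classical many-sorted logic; the only primitive relation is $=_0$. Constants: combinators; zero, successor, recursors for G\''odel's primitive recursive functionals (all types); $d$ of type $X\to(X\to1)$; $b$ of type $0$ (a positive bound on the diameter of $X$). Reals are represented by type-$1$ functionals in signed digit representation: to each $\gamma^1$ is associated primitive recursively (in the sense of Kleene) a representation $\gamma_{\mathbb{R}}$ of a real; $=_{\mathbb{R}},\leq_{\mathbb{R}}$ are $\Pi^0_1$ and $<_{\mathbb{R}}$ is $\Sigma^0_1$. $\gamma_{[0,1]}:=\max_{\mathbb{R}}(0_{\mathbb{R}},\min_{\mathbb{R}}(1_{\mathbb{R}},\gamma_{\mathbb{R}}))$, with a fixed $l^1$ such that $\gamma_{[0,1]}(n)\leq l(n)$ always; $\forall\gamma\in[0,1](\ldots\gamma\ldots)$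 stands for $\forall\gamma^1(\ldots\gamma_{[0,1]}\ldots)$, dually for $\exists$. $x=_Xy$ abbreviates $d(x,y)=_{\mathbb{R}}0_{\mathbb{R}}$. Axioms: the usual axioms for combinators and arithmetic constants (full induction scheme); Spector's weak (quantifier-free) extensionality rule; $\forall x^X,y^X\forall n^0(d(x,y)(n)=_0d(x,y)_{\mathbb{R}}(n))$; $d(x,x)=_{\mathbb{R}}0_{\mathbb{R}}$; $d(x,y)=_{\mathbb{R}}d(y,x)$; $d(x,z)\leq_{\mathbb{R}}d(x,y)+d(y,z)$; $d(x,y)\leq_{\mathbb{R}}b_{\mathbb{R}}$. **The theory $\mathcal{T_M}^+$.** Bounded formulas are built from atomic formulas by propositional connectives and the bounded quantifications $\forall k\leq_0n$, $\exists k\leq_0n$, $\forall x^X$, $\exists x^X$, $\forall\gamma\in[0,1]$, $\exists\gamma\in[0,1]$. A $\Sigma$-formula has the form $\exists n^0B(n)$ with $B$ bounded. For $f$ of type $1$, $\tilde f(n):=\max_{k\leq n}f(k)$. $\mathcal{T_M}^+$ is $\mathcal{T_M}$ plus, for all $\Sigma$-formulas $A$ (possibly with parameters): bounded choice $\forall n^0\exists k^0A(n,k)\to\exists f^1\forall n\exists k\leq\tilde f(n)A(n,k)$; and bounded collection $\forall i\leq_0m\exists n^0A(i,n)\to\exists n\forall i\leq m\exists k\leq nA(i,k)$, $\forall\gamma\in[0,1]\exists n^0A(\gamma,n)\to\exists n\forall\gamma\in[0,1]\exists k\leq nA(\gamma,k)$, $\forall x^X\exists n^0A(x,n)\to\exists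 n\forall x^X\exists k\leq nA(x,k)$. The mathematical statement is understood as formalized in this language: $U$ is a variable of type $X\to X$, $(u_n)$ of type $0\to X$, $\varphi$ of type $X\to(X\to1)$ (real-valued via representations); $x\in Fix(U)$ means $U(x)=_Xx$; $\lim_nd(U(u_n),u_n)=0$ means $\forall r\exists n\forall m\geq n\,(d(U(u_m),u_m)\leq\frac{1}{r+1})$; no extensionality or continuity of $U$, $\varphi$ is assumed. *)

(* Defs.v *)
From Stdlib Require Import List.
Import ListNotations.

Set Implicit Arguments.
Unset Strict Implicit.
Unset Printing Implicit Defensive.

(* The syntax is intrinsically typed and scoped: a context lists the types
   of the free variables, and variables are de Bruijn indices. *)

Inductive ty : Type :=
| ty0 : ty                     (* the base type 0 *)
| tyX : ty                     (* the abstract metric space *)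
| Arr : ty -> ty -> ty.

Notation "A ⇒ B" := (Arr A B) (at level 55, right associativity).
Notation ty1 := (ty0 ⇒ ty0).

Definition ctx := list ty.

Inductive var : ctx -> ty -> Type :=
| vz : forall G A, var (A :: G) A
| vs : forall G A B, var G A -> var (B :: G) A.
Arguments vz {G A}.
Arguments vs {G A B} _.

Inductive con : ty -> Type :=
| cK : forall A B, con (A ⇒ B ⇒ A)
| cS : forall A B C, con ((A ⇒ B ⇒ C) ⇒ (A ⇒ B) ⇒ A ⇒ C)
| cZero : con ty0
| cSucc : con (ty0 ⇒ ty0)
| cRec : forall A, con (ty0 ⇒ A ⇒ (A ⇒ ty0 ⇒ A) ⇒ A)
| cDist : con (tyX ⇒ tyX ⇒ ty1)
| cBound : con ty0.

Inductive tm (G : ctx) : ty -> Type :=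
| Var : forall A, var G A -> tm G A
| Con : forall A, con A -> tm G A
| App : forall A B, tm G (A ⇒ B) -> tm G A -> tm G B.
Arguments Var {G A} _.
Arguments Con {G A} _.
Arguments App {G A B} _ _.

Notation "f · a" := (App f a) (at level 20, left associativity).

Inductive fm : ctx -> Type :=
| Eq : forall G, tm G ty0 -> tm G ty0 -> fm G
| Fls : forall G, fm G
| And : forall G, fm G -> fm G -> fm G
| Or : forall G, fm G -> fm G -> fm G
| Imp : forall G, fm G -> fm G -> fm G
| All : forall G A, fm (A :: G) -> fm G
| Ex : forall G A, fm (A :: G) -> fm G.
Arguments Eq {G} _ _.
Arguments Fls {G}.
Arguments And {G} _ _.
Arguments Or {G} _ _.
Arguments Imp {G} _ _.
Arguments All {G} A _.
Arguments Ex {G} A _.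

Declare Scope fm_scope.
Delimit Scope fm_scope with fm.
Bind Scope fm_scope with fm.
Notation "s ≡ t" := (Eq s t) (at level 70, no associativity) : fm_scope.
Notation "A ⊓ B" := (And A B) (at level 80, right associativity) : fm_scope.
Notation "A ⊔ B" := (Or A B) (at level 85, right associativity) : fm_scope.
Notation "A ⟶ B" := (Imp A B) (at level 90, right associativity) : fm_scope.
Notation "¬ A" := (Imp A Fls) (at level 75, right associativity) : fm_scope.

Local Open Scope fm_scope.

Definition sub (G D : ctx) := forall A, var G A -> tm D A.

Fixpoint tsub G D (s : sub G D) A (t : tm G A) : tm D A :=
  match t with
  | Var v => s _ v
  | Con c => Con c
  | App f a => tsub s f · tsub s a
  end.

Definition shift G B : sub G (B :: G) := fun A v => Var (vs v).

Definition wk G B A (t : tm G A) : tm (B :: G) A := tsub (@shift G B) t.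
Arguments wk {G B A} t.

Definition scons G D B (t : tm D B) (s : sub G D) : sub (B :: G) D :=
  fun A v =>
    match v in var G' A'
      return match G' with
             | [] => unit
             | B' :: G0 => tm D B' -> sub G0 D -> tm D A'
             end
    with
    | vz => fun t _ => t
    | vs v => fun _ s => s _ v
    end t s.

Definition up G D B (s : sub G D) : sub (B :: G) (B :: D) :=
  scons (Var vz) (fun A v => wk (s A v)).

Definition inst G B (t : tm G B) : sub (B :: G) G := scons t (fun A v => Var v).

Fixpoint fsub G (F : fm G) : forall D, sub G D -> fm D :=
  match F with
  | Eq a b => fun D s => Eq (tsub s a) (tsub s b)
  | Fls => fun D s => Fls
  | And F1 F2 => fun D s => And (fsub F1 s) (fsub F2 s)
  | Or F1 F2 => fun D s => Or (fsub F1 s) (fsub F2 s)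
  | Imp F1 F2 => fun D s => Imp (fsub F1 s) (fsub F2 s)
  | All A F1 => fun D s => All A (fsub F1 (up s))
  | Ex A F1 => fun D s => Ex A (fsub F1 (up s))
  end.
Arguments fsub {G} F {D} s.

Definition fwk G B (F : fm G) : fm (B :: G) := fsub F (@shift G B).
Arguments fwk {G B} F.

Notation "F ⟨ t ⟩" := (fsub F (inst t)) (at level 8, left associativity).

Notation v0 := (Var vz).
Notation v1 := (Var (vs vz)).
Notation v2 := (Var (vs (vs vz))).
Notation v3 := (Var (vs (vs (vs vz)))).
Notation v4 := (Var (vs (vs (vs (vs vz))))).
Notation v5 := (Var (vs (vs (vs (vs (vs vz)))))).

(* Bracket abstraction, with constant functions given by K so that nested
   abstractions stay small. *)
Definition strengthen_var G A B (v : var (A :: G) B) : option (var G B) :=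
  match v in var G' B'
    return match G' with
           | [] => unit
           | A' :: G0 => option (var G0 B')
           end
  with
  | vz => None
  | vs v => Some v
  end.

Fixpoint strengthen G A B (t : tm (A :: G) B) : option (tm G B) :=
  match t with
  | Var v => option_map Var (strengthen_var v)
  | Con c => Some (Con c)
  | App f a =>
      match strengthen f, strengthen a with
      | Some f', Some a' => Some (f' · a')
      | _, _ => None
      end
  end.

Definition lam_var G A B (v : var (A :: G) B) : tm G (A ⇒ B) :=
  match v in var G' B'
    return match G' with
           | [] => unit
           | A' :: G0 => tm G0 (A' ⇒ B')
           end
  with
  | @vz G0 A' => Con (cS A' (A' ⇒ A') A') · Con (cK A' (A' ⇒ A')) · Con (cK A' A')
  | @vs G0 B' A' v => Con (cK B' A') · Var v
  end.

Fixpoint lam G A B (t : tm (A :: G) B) : tm G (A ⇒ B) :=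
  match t in tm _ B' return tm G (A ⇒ B') with
  | Var v => lam_var v
  | Con c => Con (cK _ _) · Con c
  | App f a =>
      match strengthen (App f a) with
      | Some t' => Con (cK _ _) · t'
      | None => Con (cS _ _ _) · lam f · lam a
      end
  end.
Arguments lam {G A B} t.

Notation "'λ' A , t" := (@lam _ A _ t) (at level 60, right associativity).

Fixpoint num (k : nat) {G : ctx} : tm G ty0 :=
  match k with
  | 0 => Con cZero
  | S k => Con cSucc · num k
  end.

Definition suc G (n : tm G ty0) : tm G ty0 := Con cSucc · n.

Definition rec G A (n : tm G ty0) (a : tm G A) (f : tm G (A ⇒ ty0 ⇒ A)) : tm G A :=
  Con (cRec A) · n · a · f.

Definition tPlus {G} : tm G (ty0 ⇒ ty0 ⇒ ty0) :=
  λ ty0, λ ty0, rec v0 v1 (λ ty0, λ ty0, suc v1).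

Definition tPred {G} : tm G (ty0 ⇒ ty0) :=
  λ ty0, rec v0 (num 0) (λ ty0, λ ty0, v0).

Definition tMonus {G} : tm G (ty0 ⇒ ty0 ⇒ ty0) :=
  λ ty0, λ ty0, rec v0 v1 (λ ty0, λ ty0, tPred · v1).

Notation "m ⊕ n" := (tPlus · m · n) (at level 50, left associativity).
Notation "m ∸ n" := (tMonus · m · n) (at level 50, left associativity).

Definition tDbl {G} : tm G (ty0 ⇒ ty0) := λ ty0, v0 ⊕ v0.

Definition tMax {G} : tm G (ty0 ⇒ ty0 ⇒ ty0) := λ ty0, λ ty0, v1 ⊕ (v0 ∸ v1).

Definition tMin {G} : tm G (ty0 ⇒ ty0 ⇒ ty0) := λ ty0, λ ty0, v1 ∸ (v1 ∸ v0).

(* sg n = 0 if n = 0, and 1 otherwise *)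
Definition tSg {G} : tm G (ty0 ⇒ ty0) := λ ty0, num 1 ∸ (num 1 ∸ v0).

(* half 0 = 0 and half (n + 1) = n - half n, i.e. half n = floor (n / 2) *)
Definition tHalf {G} : tm G (ty0 ⇒ ty0) :=
  λ ty0, rec v0 (num 0) (λ ty0, λ ty0, v0 ∸ v1).

(* cond c a b = a if c = 0, and b otherwise *)
Definition tCond {G} : tm G (ty0 ⇒ ty0 ⇒ ty0 ⇒ ty0) :=
  λ ty0, λ ty0, λ ty0, rec v2 v1 (λ ty0, λ ty0, v2).

(* f~ (n) is the maximum of f on 0, ..., n *)
Definition tTilde {G} : tm G (ty1 ⇒ ty1) :=
  λ ty1, λ ty0, rec v0 (v1 · num 0) (λ ty0, λ ty0, tMax · v1 · (v3 · suc v0)).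

Definition leN G (m n : tm G ty0) : fm G := (m ∸ n) ≡ num 0.
Definition ltN G (m n : tm G ty0) : fm G := leN (suc m) n.

(* Real numbers in signed digit representation.

   Integers are coded in type 0 by 2k |-> k and 2k+1 |-> -(k+1).
   Digits are coded by 0 |-> 0, 1 |-> +1, and every n >= 2 |-> -1.
   A function g of type 1 represents the real
       z(g 0) + sum_{i >= 1} e(g i) / 2^i.
   Integers are handled as differences of two naturals. *)

Definition tIPos {G} : tm G (ty0 ⇒ ty0) :=
  λ ty0, tCond · (v0 ∸ tDbl · (tHalf · v0)) · (tHalf · v0) · num 0.

Definition tINeg {G} : tm G (ty0 ⇒ ty0) :=
  λ ty0, tCond · (v0 ∸ tDbl · (tHalf · v0)) · num 0 · suc (tHalf · v0).

(* the code of the integer p - q *)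
Definition tICode {G} : tm G (ty0 ⇒ ty0 ⇒ ty0) :=
  λ ty0, λ ty0, tDbl · (v1 ∸ v0) ⊕ tPred · (tDbl · (v0 ∸ v1)).

(* the positive and the negative part of a digit *)
Definition tDPos {G} : tm G (ty0 ⇒ ty0) := λ ty0, v0 ∸ tDbl · (v0 ∸ num 1).
Definition tDNeg {G} : tm G (ty0 ⇒ ty0) := λ ty0, tSg · (v0 ∸ num 1).

(* g |-> g_R: digits are truncated at 2, which does not change the value *)
Definition tNorm {G} : tm G (ty1 ⇒ ty1) :=
  λ ty1, λ ty0,
    tCond · v0 · (v1 · num 0) · (tMin · (v1 · v0) · num 2).

(* tPos g n - tNeg g n is 2^n times the n-th partial sum of g, so that it
   is an integer at distance at most 1 from 2^n times the real g. *)
Definition tPos {G} : tm G (ty1 ⇒ ty1) :=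
  λ ty1, λ ty0,
    rec v0 (tIPos · (v1 · num 0))
      (λ ty0, λ ty0, tDbl · v1 ⊕ tDPos · (v3 · suc v0)).

Definition tNeg {G} : tm G (ty1 ⇒ ty1) :=
  λ ty1, λ ty0,
    rec v0 (tINeg · (v1 · num 0))
      (λ ty0, λ ty0, tDbl · v1 ⊕ tDNeg · (v3 · suc v0)).

Definition leR G (x y : tm G ty1) : fm G :=
  All ty0 (leN (tPos · wk x · v0 ⊕ tNeg · wk y · v0)
            (tPos · wk y · v0 ⊕ tNeg · wk x · v0 ⊕ num 2)).

Definition eqR G (x y : tm G ty1) : fm G :=
  All ty0 (leN (tPos · wk x · v0 ⊕ tNeg · wk y · v0)
            (tPos · wk y · v0 ⊕ tNeg · wk x · v0 ⊕ num 2)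
         ⊓ leN (tPos · wk y · v0 ⊕ tNeg · wk x · v0)
              (tPos · wk x · v0 ⊕ tNeg · wk y · v0 ⊕ num 2)).

Definition ltR G (x y : tm G ty1) : fm G :=
  Ex ty0 (ltN (tPos · wk x · v0 ⊕ tNeg · wk y · v0 ⊕ num 2)
           (tPos · wk y · v0 ⊕ tNeg · wk x · v0)).

(* m |-> m_R *)
Definition tNat {G} : tm G (ty0 ⇒ ty1) :=
  λ ty0, λ ty0, tCond · v0 · (tDbl · v1) · num 0.

(* k |-> 1/(k+1), by long division: the n-th remainder tRem k n is
   2^n modulo k+1, and the next binary digit is 1 iff k+1 <= 2 * tRem k n. *)
Definition tRem {G} : tm G (ty0 ⇒ ty0 ⇒ ty0) :=
  λ ty0, λ ty0,
    rec v0 (tSg · v1)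
      (λ ty0, λ ty0,
        tCond · (tDbl · v1 ∸ v3) · (tDbl · v1) · (tDbl · v1 ∸ suc v3)).

Definition tInv {G} : tm G (ty0 ⇒ ty1) :=
  λ ty0, λ ty0,
    rec v0 (tDbl · (num 1 ∸ v1))
      (λ ty0, λ ty0, tSg · (tDbl · (tRem · v3 · v0) ∸ v3)).

(* Conversion to signed digits.  If p, q of type 1 are such that
   |(p n - q n) / 2^n - x| <= 2 / 2^n for all n, then tConv p q represents
   the real x.  The integers c_n coded by tPart p q n satisfy
   |c_n - 2^n x| <= 1: c_0 is (p 2 - q 2) / 4 rounded to a nearest integer,
   and c_(n+1) = 2 c_n + e, where the digit e is 1, -1 or 0 according to
   whether p(n+3) - q(n+3) - 8 c_n is > 2, < -2 or neither. *)
Definition tRound {G} : tm G (ty0 ⇒ ty0) := λ ty0, tHalf · (tHalf · (v0 ⊕ num 2)).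

Definition t8 {G} : tm G (ty0 ⇒ ty0) := λ ty0, tDbl · (tDbl · (tDbl · v0)).

(* λ p q n c *)
Definition tDigit {G} : tm G (ty1 ⇒ ty1 ⇒ ty0 ⇒ ty0 ⇒ ty0) :=
  λ ty1, λ ty1, λ ty0, λ ty0,
    tSg · ((v3 · suc (suc (suc v1)) ⊕ t8 · (tINeg · v0))
            ∸ (v2 · suc (suc (suc v1)) ⊕ t8 · (tIPos · v0) ⊕ num 2))
    ⊕ tDbl · (tSg · ((v2 · suc (suc (suc v1)) ⊕ t8 · (tIPos · v0))
            ∸ (v3 · suc (suc (suc v1)) ⊕ t8 · (tINeg · v0) ⊕ num 2))).

Definition tPart {G} : tm G (ty1 ⇒ ty1 ⇒ ty1) :=
  λ ty1, λ ty1, λ ty0,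
    rec v0
      (tICode · (tRound · (v2 · num 2 ∸ v1 · num 2))
              · (tRound · (v1 · num 2 ∸ v2 · num 2)))
      (λ ty0, λ ty0,
        tICode · (tDbl · (tIPos · v1) ⊕ tDPos · (tDigit · v4 · v3 · v0 · v1))
               · (tDbl · (tINeg · v1) ⊕ tDNeg · (tDigit · v4 · v3 · v0 · v1))).

Definition tConv {G} : tm G (ty1 ⇒ ty1 ⇒ ty1) :=
  λ ty1, λ ty1, λ ty0,
    rec v0 (tPart · v2 · v1 · num 0)
      (λ ty0, λ ty0, tDigit · v4 · v3 · v0 · (tPart · v4 · v3 · v0)).

Definition tAddR {G} : tm G (ty1 ⇒ ty1 ⇒ ty1) :=
  λ ty1, λ ty1,
    tConv · (λ ty0, tPos · v2 · v0 ⊕ tPos · v1 · v0)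
          · (λ ty0, tNeg · v2 · v0 ⊕ tNeg · v1 · v0).

(* max (p - q, p' - q') = max (p + q', p' + q) - (q + q'), same for min *)
Definition tMaxR {G} : tm G (ty1 ⇒ ty1 ⇒ ty1) :=
  λ ty1, λ ty1,
    tConv · (λ ty0, tMax · (tPos · v2 · v0 ⊕ tNeg · v1 · v0)
                       · (tPos · v1 · v0 ⊕ tNeg · v2 · v0))
          · (λ ty0, tNeg · v2 · v0 ⊕ tNeg · v1 · v0).

Definition tMinR {G} : tm G (ty1 ⇒ ty1 ⇒ ty1) :=
  λ ty1, λ ty1,
    tConv · (λ ty0, tMin · (tPos · v2 · v0 ⊕ tNeg · v1 · v0)
                       · (tPos · v1 · v0 ⊕ tNeg · v2 · v0))
          · (λ ty0, tNeg · v2 · v0 ⊕ tNeg · v1 · v0).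

(* g |-> g_[0,1].  Its values are at most 2. *)
Definition tClip {G} : tm G (ty1 ⇒ ty1) :=
  λ ty1,
    tMaxR · (tNat · num 0) · (tMinR · (tNat · num 1) · (tNorm · v0)).

Notation "x +R y" := (tAddR · x · y) (at level 50, left associativity).
Notation "x ≤R y" := (leR x y) (at level 70, no associativity) : fm_scope.
Notation "x <R y" := (ltR x y) (at level 70, no associativity) : fm_scope.
Notation "x =R y" := (eqR x y) (at level 70, no associativity) : fm_scope.

(* Equality at all types: =_0 is primitive, x =_X y is d(x,y) =_R 0, and
   equality at an arrow type is pointwise. *)

Notation dist x y := (Con cDist · x · y).

Fixpoint eqt {G} (A : ty) : tm G A -> tm G A -> fm G :=
  match A with
  | ty0 => fun s t => Eq s t
  | tyX => fun s t => eqR (dist s t) (tNat · num 0)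
  | B ⇒ C => fun s t => All B (eqt (wk s · v0) (wk t · v0))
  end.
Arguments eqt {G A} s t.

Definition AllLe G (t : tm G ty0) (F : fm (ty0 :: G)) : fm G :=
  All ty0 (leN v0 (wk t) ⟶ F).
Definition ExLe G (t : tm G ty0) (F : fm (ty0 :: G)) : fm G :=
  Ex ty0 (leN v0 (wk t) ⊓ F).

(* F(g) |-> F(g_[0,1]) *)
Definition clip G (F : fm (ty1 :: G)) : fm (ty1 :: G) :=
  fsub F (scons (tClip · v0) (@shift G ty1)).

Definition All01 G (F : fm (ty1 :: G)) : fm G := All ty1 (clip F).
Definition Ex01 G (F : fm (ty1 :: G)) : fm G := Ex ty1 (clip F).

Inductive qf : forall G, fm G -> Prop :=
| qf_Eq : forall G (s t : tm G ty0), qf (Eq s t)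
| qf_Fls : forall G, qf (@Fls G)
| qf_And : forall G (F F' : fm G), qf F -> qf F' -> qf (And F F')
| qf_Or : forall G (F F' : fm G), qf F -> qf F' -> qf (Or F F')
| qf_Imp : forall G (F F' : fm G), qf F -> qf F' -> qf (Imp F F').

Inductive bounded : forall G, fm G -> Prop :=
| bd_Eq : forall G (s t : tm G ty0), bounded (Eq s t)
| bd_Fls : forall G, bounded (@Fls G)
| bd_And : forall G (F F' : fm G), bounded F -> bounded F' -> bounded (And F F')
| bd_Or : forall G (F F' : fm G), bounded F -> bounded F' -> bounded (Or F F')
| bd_Imp : forall G (F F' : fm G), bounded F -> bounded F' -> bounded (Imp F F')
| bd_AllLe : forall G (t : tm G ty0) F, bounded F -> bounded (AllLe t F)
| bd_ExLe : forall G (t : tm G ty0) F, bounded F -> bounded (ExLe t F)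
| bd_AllX : forall G (F : fm (tyX :: G)), bounded F -> bounded (All tyX F)
| bd_ExX : forall G (F : fm (tyX :: G)), bounded F -> bounded (Ex tyX F)
| bd_All01 : forall G (F : fm (ty1 :: G)), bounded F -> bounded (All01 F)
| bd_Ex01 : forall G (F : fm (ty1 :: G)), bounded F -> bounded (Ex01 F).

Inductive Sigma : forall G, fm G -> Prop :=
| Sigma_intro : forall G (B : fm (ty0 :: G)), bounded B -> Sigma (Ex ty0 B).

(* Classical many-sorted natural deduction with hypotheses.  All sorts are
   nonempty (pf_nonempty), as usual in many-sorted logic.  In the weak
   extensionality rule the premise must be derived without hypotheses. *)

Definition theory := forall G, fm G -> Prop.

Inductive prov (T : theory) : forall G, list (fm G) -> fm G -> Prop :=
| pf_ax : forall G H (F : fm G), T G F -> prov T H F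
| pf_hyp : forall G H (F : fm G), In F H -> prov T H F
| pf_ImpI : forall G H (A B : fm G), prov T (A :: H) B -> prov T H (A ⟶ B)
| pf_ImpE : forall G H (A B : fm G), prov T H (A ⟶ B) -> prov T H A -> prov T H B
| pf_AndI : forall G H (A B : fm G), prov T H A -> prov T H B -> prov T H (A ⊓ B)
| pf_AndE1 : forall G H (A B : fm G), prov T H (A ⊓ B) -> prov T H A
| pf_AndE2 : forall G H (A B : fm G), prov T H (A ⊓ B) -> prov T H B
| pf_OrI1 : forall G H (A B : fm G), prov T H A -> prov T H (A ⊔ B)
| pf_OrI2 : forall G H (A B : fm G), prov T H B -> prov T H (A ⊔ B)
| pf_OrE : forall G H (A B C : fm G),
    prov T H (A ⊔ B) -> prov T (A :: H) C -> prov T (B :: H) C -> prov T H C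
| pf_raa : forall G H (A : fm G), prov T ((¬ A) :: H) Fls -> prov T H A
| pf_AllI : forall G H A (F : fm (A :: G)), prov T (map fwk H) F -> prov T H (All A F)
| pf_AllE : forall G H A (F : fm (A :: G)) t, prov T H (All A F) -> prov T H F⟨t⟩
| pf_ExI : forall G H A (F : fm (A :: G)) t, prov T H F⟨t⟩ -> prov T H (Ex A F)
| pf_ExE : forall G H A (F : fm (A :: G)) C,
    prov T H (Ex A F) -> prov T (F :: map fwk H) (fwk C) -> prov T H C
| pf_nonempty : forall G H A (F : fm G), @prov T (A :: G) (map fwk H) (fwk F) -> prov T H F
| pf_refl : forall G H (s : tm G ty0), prov T H (s ≡ s)
| pf_leibniz : forall G H (s t : tm G ty0) (F : fm (ty0 :: G)),
    prov T H (s ≡ t) -> prov T H F⟨s⟩ -> prov T H F⟨t⟩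
| pf_ext : forall G H A B (F : fm G) (s t : tm G A) (r : tm (A :: G) B),
    qf F ->
    prov T [] (F ⟶ eqt s t) ->
    prov T H (F ⟶ eqt (tsub (inst s) r) (tsub (inst t) r)).

Notation "T ⊢ F" := (@prov T [] [] F) (at level 99, no associativity).

Inductive T_M : forall G, fm G -> Prop :=
| ax_K : forall G A B (x : tm G A) (y : tm G B),
    T_M (eqt (Con (cK A B) · x · y) x)
| ax_S : forall G A B C (x : tm G (A ⇒ B ⇒ C)) y z,
    T_M (eqt (Con (cS A B C) · x · y · z) (x · z · (y · z)))
| ax_rec0 : forall G A (a : tm G A) f,
    T_M (eqt (rec (num 0) a f) a)
| ax_recS : forall G A n (a : tm G A) f,
    T_M (eqt (rec (suc n) a f) (f · rec n a f · n))
| ax_succ_nz : forall G (n : tm G ty0),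
    T_M (¬ (suc n ≡ num 0))
| ax_succ_inj : forall G (m n : tm G ty0),
    T_M (suc m ≡ suc n ⟶ m ≡ n)
| ax_ind : forall G (F : fm (ty0 :: G)),
    T_M (F⟨num 0⟩
         ⟶ All ty0 (F ⟶ fsub F (scons (suc v0) (@shift G ty0)))
         ⟶ All ty0 F)
| ax_dist_norm : forall G (x y : tm G tyX) n,
    T_M (dist x y · n ≡ tNorm · dist x y · n)
| ax_dist_refl : forall G (x : tm G tyX),
    T_M (dist x x =R tNat · num 0)
| ax_dist_sym : forall G (x y : tm G tyX),
    T_M (dist x y =R dist y x)
| ax_dist_triangle : forall G (x y z : tm G tyX),
    T_M (dist x z ≤R dist x y +R dist y z)
| ax_dist_bound : forall G (x y : tm G tyX),
    T_M (dist x y ≤R tNat · Con cBound).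

(* In the conclusions of the schemes of T_Mplus the formula is weakened by
   the new variable f, resp. n, placed below its own two variables. *)

Definition shift2 G A A' B : sub (A :: A' :: G) (A :: A' :: B :: G) :=
  up (up (@shift G B)).

Inductive T_Mplus : forall G, fm G -> Prop :=
| ax_base : forall G (F : fm G), T_M F -> T_Mplus F
| ax_bounded_choice : forall G (F : fm (ty0 (* k *) :: ty0 (* n *) :: G)),
    Sigma F ->
    T_Mplus (All ty0 (Ex ty0 F)
             ⟶ Ex ty1 (All ty0 (ExLe (tTilde · v1 · v0)
                                (fsub F (@shift2 G ty0 ty0 ty1)))))
| ax_collection_nat : forall G (m : tm G ty0) (F : fm (ty0 (* n *) :: ty0 (* i *) :: G)),
    Sigma F ->
    T_Mplus (AllLe m (Ex ty0 F)
             ⟶ Ex ty0 (AllLe (wk m) (ExLe v1 (fsub F (@shift2 G ty0 ty0 ty0)))))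
| ax_collection_01 : forall G (F : fm (ty0 (* n *) :: ty1 (* g *) :: G)),
    Sigma F ->
    T_Mplus (All01 (Ex ty0 F)
             ⟶ Ex ty0 (All01 (ExLe v1 (fsub F (@shift2 G ty0 ty1 ty0)))))
| ax_collection_X : forall G (F : fm (ty0 (* n *) :: tyX (* x *) :: G)),
    Sigma F ->
    T_Mplus (All tyX (Ex ty0 F)
             ⟶ Ex ty0 (All tyX (ExLe v1 (fsub F (@shift2 G ty0 tyX ty0))))).

Definition isFix G (U : tm G (tyX ⇒ tyX)) (x : tm G tyX) : fm G := eqt (U · x) x.

(* Main.v *)
(* Let x be an eps-minimiser on F. Prenexing, for every y there is an n such that
   the n-th approximation of d(U y, y) = 0 implies the n-th instance of
   phi(x,x) < phi(x,y) + 1/(k+1). Bounded collection over X gives a bound N on n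
   which is uniform in y, so that only finitely many approximations of
   d(U y, y) = 0 are used, and these follow from d(U y, y) <= 1/(2^N + 1), which
   holds for y = u_m with m large.

   Formal derivations are found semantically: a formula is derivable from H iff
   it belongs to every maximal consistent set M containing H (Lindenbaum). The
   terms of type 0 modulo the equations in M form a discretely ordered
   semigroup, in which linear arithmetic is decided by Farkas certificates;
   quantifiers are treated by passing to a maximal consistent set over one more
   variable. *)
Require Import Defs.
From Stdlib Require Import List Classical FunctionalExtensionality Program.Equality.
From Stdlib Require Import Setoid Morphisms PeanoNat BinInt.
From mathcomp Require classical_sets.
Import ListNotations.

Set Implicit Arguments.
Unset Strict Implicit.
Unset Printing Implicit Defensive.
Set Bullet Behavior "Strict Subproofs".

Open Scope fm_scope.

(** * Substitution *)

(** The collected [y] ranges over all of X, fixed points or not, so u_m may be substituted for it: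
    uniformity of N replaces any comparison of phi at nearby points. Most of the development serves
    one passage, from d(U u_m, u_m) <= 1/(2^N + 1) to the approximations of d(U u_m, u_m) = 0 of
    index n <= N. Its upper half holds because the integer part and the first N binary digits of
    1/(2^N + 1) vanish. Its lower half is nonnegativity of d up to the tolerance 2 of the
    approximations. This is no axiom and has to be extracted from the triangle inequality on the
    level of representations, hence through one half of the correctness of signed digit addition,
    inside the formal theory. What remains there is linear arithmetic over integers once digits,
    codes and truncated differences have been split into cases. Weak extensionality forbids
    replacing equals by equals at higher types under hypotheses. The higher-type equations used are
    axioms, derivable without hypotheses, so they may be replaced in every context. *)

Lemma sub_ext G D (s s' : sub G D) : (forall A v, s A v = s' A v) -> s = s'.
Proof. intros E; extensionality A; extensionality v; apply E. Qed.

Definition scomp G D E (s : sub G D) (s' : sub D E) : sub G E :=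
  fun A v => tsub s' (s A v).

Lemma tsub_comp G A (t : tm G A) D E (s : sub G D) (s' : sub D E) :
  tsub s' (tsub s t) = tsub (scomp s s') t.
Proof. induction t; cbn; rewrite ?IHt1, ?IHt2; reflexivity. Qed.

Lemma scomp_scons G D E B (t : tm D B) (s : sub G D) (s' : sub D E) :
  scomp (scons t s) s' = scons (tsub s' t) (scomp s s').
Proof. apply sub_ext; intros A v; dependent destruction v; reflexivity. Qed.

Lemma tsub_id G A (t : tm G A) : tsub (fun A v => Var v) t = t.
Proof. induction t; cbn; rewrite ?IHt1, ?IHt2; reflexivity. Qed.

Lemma tsub_inst_wk G B A (t : tm G A) (a : tm G B) : tsub (inst a) (wk t) = t.
Proof. unfold wk; rewrite tsub_comp; apply tsub_id. Qed.

Lemma tsub_scons_wk G D B A (t : tm G A) (a : tm D B) (s : sub G D) :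
  tsub (scons a s) (wk t) = tsub s t.
Proof. unfold wk; rewrite tsub_comp; reflexivity. Qed.

Lemma tsub_up_wk G D B A (t : tm G A) (s : sub G D) :
  tsub (up s) (wk t) = wk (B := B) (tsub s t).
Proof. unfold wk; rewrite !tsub_comp; reflexivity. Qed.

Lemma tsub_shift G B A (t : tm G A) : tsub (@shift G B) t = wk t.
Proof. reflexivity. Qed.

Lemma scomp_up G D E B (s : sub G D) (s' : sub D E) :
  scomp (up (B := B) s) (up s') = up (scomp s s').
Proof.
apply sub_ext; intros A v; dependent destruction v; [reflexivity|].
apply tsub_up_wk.
Qed.

Lemma up_id G B : up (B := B) (fun A (v : var G A) => Var v) = fun A v => Var v.
Proof. apply sub_ext; intros A v; dependent destruction v; reflexivity. Qed.

Lemma fsub_comp G (F : fm G) : forall D E (s : sub G D) (s' : sub D E),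
  fsub (fsub F s) s' = fsub F (scomp s s').
Proof.
induction F; intros D E s s'; cbn; rewrite ?tsub_comp, ?IHF1, ?IHF2, ?IHF, ?scomp_up;
  reflexivity.
Qed.

Lemma fsub_id G (F : fm G) : fsub F (fun A v => Var v) = F.
Proof. induction F; cbn; rewrite ?tsub_id, ?up_id, ?IHF1, ?IHF2, ?IHF; reflexivity. Qed.

Lemma fsub_up_shift_inst G A (F : fm (A :: G)) :
  fsub (fsub F (up (@shift G A))) (inst (Var vz)) = F.
Proof.
rewrite fsub_comp; rewrite <- (fsub_id F) at 2; f_equal.
apply sub_ext; intros B v; dependent destruction v; reflexivity.
Qed.

Lemma strengthen_wk G B A (t : tm G A) : strengthen (wk (B := B) t) = Some t.
Proof.
induction t; cbn; try reflexivity.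
unfold wk in *; rewrite IHt1, IHt2; reflexivity.
Qed.

Lemma wk_strengthen G B A (t : tm (B :: G) A) t' : strengthen t = Some t' -> t = wk t'.
Proof.
dependent induction t; cbn; intros E.
- dependent destruction v; cbn in E; [discriminate|].
  injection E as <-; reflexivity.
- injection E as <-; reflexivity.
- destruct (strengthen t1) as [f|] eqn:E1; [|discriminate].
  destruct (strengthen t2) as [a|] eqn:E2; [|discriminate].
  injection E as <-; cbn.
  rewrite (IHt1 _ eq_refl), (IHt2 _ eq_refl).
  reflexivity.
Qed.

(** The case [None] matters as much as [Some]: a lifted substitution neither removes nor introduces
    the bound variable, so [lam] takes the same branch before and after it. This is what makes
    bracket abstraction commute with substitution. *)
Lemma strengthen_up G D B A (t : tm (B :: G) A) (s : sub G D) :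
  strengthen (tsub (up s) t) = option_map (@tsub _ _ s _) (strengthen t).
Proof.
dependent induction t; cbn.
- dependent destruction v; cbn; [reflexivity|apply strengthen_wk].
- reflexivity.
- rewrite IHt1, IHt2.
  destruct (strengthen t1), (strengthen t2); reflexivity.
Qed.

Lemma lam_wk G A B (t : tm G B) : lam (wk (B := A) t) = Con (cK _ _) · t.
Proof.
destruct t; try reflexivity.
change (wk (B := A) (t1 · t2)) with (wk (B := A) t1 · wk t2); cbn.
rewrite !strengthen_wk; reflexivity.
Qed.

Lemma tsub_lam G D A B (t : tm (A :: G) B) (s : sub G D) :
  tsub s (lam t) = lam (tsub (up s) t).
Proof.
dependent induction t.
- dependent destruction v; [reflexivity|].
  symmetry; apply lam_wk.
- reflexivity.
- cbn [tsub]; cbn [lam].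
  rewrite <- IHt1, <- IHt2.
  change (tsub (up s) t1 · tsub (up s) t2) with (tsub (up s) (t1 · t2)).
  rewrite strengthen_up.
  destruct (strengthen (t1 · t2)); reflexivity.
Qed.

(** * Maximal consistent sets *)

Notation "H ⊩ F" := (prov T_Mplus H F) (at level 99, no associativity).

Lemma prov_incl (T : theory) G (H : list (fm G)) F :
  prov T H F -> forall H', incl H H' -> prov T H' F.
Proof.
induction 1; intros H' I.
- now apply pf_ax.
- now apply pf_hyp, I.
- apply pf_ImpI, IHprov. intros x [<-|K]; [now left|right; auto].
- eapply pf_ImpE; [apply IHprov1|apply IHprov2]; auto.
- apply pf_AndI; auto.
- eapply pf_AndE1; auto.
- eapply pf_AndE2; auto.
- apply pf_OrI1; auto.
- apply pf_OrI2; auto.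
- eapply pf_OrE; [apply IHprov1; auto|apply IHprov2|apply IHprov3];
    intros x [<-|K]; ((now left) || (right; auto)).
- apply pf_raa, IHprov. intros x [<-|K]; [now left|right; auto].
- apply pf_AllI, IHprov, incl_map, I.
- apply pf_AllE; auto.
- eapply pf_ExI; auto.
- eapply pf_ExE; [apply IHprov1; auto|apply IHprov2].
  intros x [<-|K]; [now left|right; now apply (incl_map _ I)].
- eapply pf_nonempty, IHprov, incl_map, I.
- apply pf_refl.
- eapply pf_leibniz; auto.
- now apply pf_ext.
Qed.

Lemma prov_cut G (H : list (fm G)) F F' : (H ⊩ F) -> (F :: H ⊩ F') -> (H ⊩ F').
Proof. intros P Q; exact (pf_ImpE (pf_ImpI Q) P). Qed.

Lemma prov_exfalso G (H : list (fm G)) F : (H ⊩ Fls) -> (H ⊩ F).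
Proof.
intros P; apply pf_raa; apply (prov_incl P); intros x K; now right.
Qed.

(** No Henkin witnesses are demanded: an existential formula in the set need not have an instance by
    a term. This is why quantifiers lead to sets over a larger context. *)
Record mcs G := {
  mem : fm G -> Prop;
  mcs_closed : forall H F, (forall A, In A H -> mem A) -> (H ⊩ F) -> mem F;
  mcs_consistent : ~ mem Fls;
  mcs_complete : forall F, mem F \/ mem (¬ F) }.

Notation "M ⊨ F" := (mem M F) (at level 99, no associativity).

(** Occurrences of [F] may be scattered through [L]. Each head of the list is moved into an
    implication, and is afterwards either restored by modus ponens or, if it is [F], discharged by
    the single copy in front. *)
Lemma remove_formula G (S : fm G -> Prop) F (L : list (fm G)) F' :
  (forall A, In A L -> S A \/ A = F) -> (L ⊩ F') ->
  exists L', (forall A, In A L' -> S A) /\ (F :: L' ⊩ F').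
Proof.
revert F'; induction L as [|A L IH]; intros F' I P.
- exists []; split; [intros A []|apply (prov_incl P); intros x []].
- destruct (IH (A ⟶ F')) as [L' [I' P']].
  + intros B K; apply I; now right.
  + now apply pf_ImpI.
  + destruct (I A (or_introl eq_refl)) as [K|K].
    * exists (A :: L'); split; [intros B [<-|J]; auto|].
      refine (pf_ImpE (prov_incl P' _) (pf_hyp _ _)); [|right; now left].
      intros x [<-|J]; [now left|right; now right].
    * exists L'; split; [auto|].
      refine (pf_ImpE P' (pf_hyp _ _)); left; auto.
Qed.

Lemma lindenbaum G (H : list (fm G)) :
  ~ (H ⊩ Fls) -> exists M : mcs G, forall A, In A H -> M ⊨ A.
Proof.
intros C.
(* [H] is built into the consistency condition instead of being required inside [S], because Zorn's
   lemma also asks for the union of the empty chain. *)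
set (P := fun S : fm G -> Prop =>
  forall L, (forall A, In A L -> S A \/ In A H) -> ~ (L ⊩ Fls)).
destruct (@classical_sets.Zorn_bigcup (fm G) P) as [S [PS maxS]].
- intros F FP tot L I Q.
  (* A derivation uses finitely many formulas, so along a chain one member already contains all
     those outside [H]. *)
  assert (U : (forall A, In A L -> In A H) \/
              exists X, F X /\ forall A, In A L -> X A \/ In A H).
  { clear Q; induction L as [|A L IH]; [left; intros A []|].
    destruct IH as [IH|[X [FX IH]]]; [intros B K; apply I; now right| |];
      destruct (I A (or_introl eq_refl)) as [[Y FY YA]|K].
    - right; exists Y; split; [assumption|].
      intros B [<-|J]; [now left|right; auto].
    - left; intros B [<-|J]; auto.
    - right; destruct (tot X Y FX FY) as [XY|YX].
      + exists Y; split; [assumption|].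
        intros B [<-|J]; [now left|destruct (IH B J); [left; now apply XY|now right]].
      + exists X; split; [assumption|].
        intros B [<-|J]; [left; now apply YX|auto].
    - right; exists X; split; [assumption|].
      intros B [<-|J]; auto. }
  destruct U as [U|[X [FX U]]]; [now apply C, (prov_incl Q)|exact (FP X FX L U Q)].
- set (M := fun A => S A \/ In A H).
  assert (cl : forall L F, (forall A, In A L -> M A) -> (L ⊩ F) -> M F).
  { intros L F I Q; apply NNPP; intros N.
    (* A derivable formula outside the maximal set would give a strictly larger consistent set: a
       refutation that uses [F] can be cut against the derivation of [F]. *)
    apply (maxS (fun A => S A \/ A = F)).
    { split; [intros A K; now left|].
      intros K; apply N; left; apply K; now right. }
    intros L' I' Q'.
    destruct (@remove_formula G M F L' Fls) as [L'' [I'' Q'']]; [|exact Q'|].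
    { intros A K; destruct (I' A K) as [[?|?]|?]; [left; now left|now right|left; now right]. }
    apply (PS (L ++ L'')).
    { intros A K; apply in_app_iff in K as [K|K]; [exact (I A K)|exact (I'' A K)]. }
    apply (@prov_cut _ _ F).
    - apply (prov_incl Q); apply incl_appl, incl_refl.
    - apply (prov_incl Q''); intros x [<-|K]; [now left|right; now apply in_or_app; right]. }
  unshelve refine (ex_intro _ (@Build_mcs G M cl _ _) _); [| |now right].
  + intros N; apply (PS [Fls]); [intros A [<-|[]]; exact N|apply pf_hyp; now left].
  + intros F; apply NNPP; intros N.
    assert (N1 : ~ M F) by tauto. assert (N2 : ~ M (¬ F)) by tauto.
    apply (maxS (fun A => S A \/ A = F)).
    { split; [intros A K; now left|].
      intros K; apply N1; left; apply K; now right. }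
    intros L' I' Q'.
    destruct (@remove_formula G M F L' Fls) as [L'' [I'' Q'']]; [|exact Q'|].
    { intros A K; destruct (I' A K) as [[?|?]|?]; [left; now left|now right|left; now right]. }
    apply N2, (cl L''); [exact I''|now apply pf_ImpI].
Qed.

Lemma prov_mcs G (H : list (fm G)) F :
  (forall M : mcs G, (forall A, In A H -> M ⊨ A) -> M ⊨ F) -> (H ⊩ F).
Proof.
intros V; apply NNPP; intros N.
destruct (@lindenbaum G ((¬ F) :: H)) as [M I].
- intros Q; now apply N, pf_raa.
- apply (mcs_consistent (m := M)), (mcs_closed (H := [F; ¬ F])).
  + intros A [<-|[<-|[]]]; [apply V; intros A K; apply I; now right|].
    apply I; now left.
  + refine (pf_ImpE (pf_hyp _ _) (pf_hyp _ _)); [right|]; now left.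
Qed.

(** * Connectives, quantifiers, induction and equality in a maximal consistent set *)

Lemma mcs_prov G (M : mcs G) F : ([] ⊩ F) -> (M ⊨ F).
Proof. intros P; apply (mcs_closed (H := [])); [intros A []|exact P]. Qed.

Lemma mcs_ax G (M : mcs G) F : T_M F -> (M ⊨ F).
Proof. intros P; now apply mcs_prov, pf_ax, ax_base. Qed.

Lemma mcs_And G (M : mcs G) F F' : (M ⊨ F ⊓ F') <-> (M ⊨ F) /\ (M ⊨ F').
Proof.
split; [intros K; split|intros [K K']].
- apply (mcs_closed (H := [F ⊓ F'])); [intros A [<-|[]]; exact K|].
  eapply pf_AndE1, pf_hyp; now left.
- apply (mcs_closed (H := [F ⊓ F'])); [intros A [<-|[]]; exact K|].
  eapply pf_AndE2, pf_hyp; now left.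
- apply (mcs_closed (H := [F; F'])); [intros A [<-|[<-|[]]]; assumption|].
  apply pf_AndI; apply pf_hyp; [now left|right; now left].
Qed.

Lemma mcs_Imp G (M : mcs G) F F' : (M ⊨ F ⟶ F') <-> ((M ⊨ F) -> (M ⊨ F')).
Proof.
split.
- intros K K'; apply (mcs_closed (H := [F; F ⟶ F'])).
  + intros A [<-|[<-|[]]]; assumption.
  + refine (pf_ImpE (pf_hyp _ _) (pf_hyp _ _)); [right|]; now left.
- intros K; destruct (mcs_complete M F) as [J|J].
  + apply (mcs_closed (H := [F'])); [intros A [<-|[]]; auto|].
    apply pf_ImpI, pf_hyp; right; now left.
  + apply (mcs_closed (H := [¬ F])); [intros A [<-|[]]; auto|].
    apply pf_ImpI, prov_exfalso.
    refine (pf_ImpE (pf_hyp _ _) (pf_hyp _ _)); [right|]; now left.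
Qed.

Lemma mcs_Not G (M : mcs G) F : (M ⊨ ¬ F) <-> ~ (M ⊨ F).
Proof.
rewrite mcs_Imp; split; [intros K J; now apply (mcs_consistent (m := M)), K|tauto].
Qed.

Lemma mcs_Or G (M : mcs G) F F' : (M ⊨ F ⊔ F') <-> (M ⊨ F) \/ (M ⊨ F').
Proof.
split.
- intros K; apply NNPP; intros N; apply (mcs_consistent (m := M)).
  apply (mcs_closed (H := [F ⊔ F'; ¬ F; ¬ F'])).
  + intros A [<-|[<-|[<-|[]]]]; rewrite ?mcs_Not; tauto.
  + apply (pf_OrE (A := F) (B := F')); [apply pf_hyp; now left| |];
      refine (pf_ImpE (pf_hyp _ _) (pf_hyp _ _)); try (now left);
      do 2 right; [left|right; left]; reflexivity.
- intros [K|K]; [apply (mcs_closed (H := [F]))|apply (mcs_closed (H := [F']))];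
    try (intros A [<-|[]]; assumption); [apply pf_OrI1|apply pf_OrI2]; apply pf_hyp; now left.
Qed.

Lemma mcs_AllE G (M : mcs G) A (F : fm (A :: G)) t :
  (M ⊨ All A F) -> (M ⊨ F⟨t⟩).
Proof.
intros K; apply (mcs_closed (H := [All A F])); [intros B [<-|[]]; exact K|].
apply pf_AllE, pf_hyp; now left.
Qed.

Lemma mcs_ExI G (M : mcs G) A (F : fm (A :: G)) t :
  (M ⊨ F⟨t⟩) -> (M ⊨ Ex A F).
Proof.
intros K; apply (mcs_closed (H := [F⟨t⟩])); [intros B [<-|[]]; exact K|].
apply (pf_ExI (t := t)), pf_hyp; now left.
Qed.

Lemma mcs_AllI G (M : mcs G) H A (F : fm (A :: G)) :
  (forall B, In B H -> M ⊨ B) ->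
  (forall M' : mcs _, (forall B, In B H -> M' ⊨ fwk B) -> (M' ⊨ F)) ->
  (M ⊨ All A F).
Proof.
intros I V; apply (mcs_closed (H := H)); [exact I|].
apply pf_AllI, prov_mcs; intros M' I'; apply (V M').
intros B K; now apply I', in_map.
Qed.

(* The hypotheses [H] stand in for the infinite set [M], which cannot be
   weakened as a whole by the induction variable. *)
Lemma mcs_ind G (M : mcs G) H (F : fm (ty0 :: G)) t :
  (forall B, In B H -> M ⊨ B) ->
  (M ⊨ F⟨num 0⟩) ->
  (forall M' : mcs _, (forall B, In B H -> M' ⊨ fwk B) -> (M' ⊨ F) ->
     (M' ⊨ fsub F (scons (suc v0) (@shift G ty0)))) ->
  (M ⊨ F⟨t⟩).
Proof.
intros I V0 VS; apply mcs_AllE.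
assert (K : M ⊨ F⟨num 0⟩ ⟶ All ty0 (F ⟶ fsub F (scons (suc v0) (@shift G ty0)))
              ⟶ All ty0 F) by apply mcs_ax, ax_ind.
rewrite !mcs_Imp in K; apply (K V0).
apply (mcs_AllI I); intros M' I'; rewrite mcs_Imp; now apply VS.
Qed.

(* Only hypothesis-free equations at higher types may be substituted (weak
   extensionality), so [eqt] is no congruence in [M]; this relation is one. *)
Definition eqv G (M : mcs G) A (s t : tm G A) : Prop :=
  forall r : tm (A :: G) ty0, M ⊨ tsub (inst s) r ≡ tsub (inst t) r.

Lemma mcs_refl G (M : mcs G) (s : tm G ty0) : M ⊨ s ≡ s.
Proof. apply mcs_prov, pf_refl. Qed.

Lemma mcs_leibniz G (M : mcs G) (s t : tm G ty0) F :
  (M ⊨ s ≡ t) -> (M ⊨ F⟨s⟩) -> (M ⊨ F⟨t⟩).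
Proof.
intros E K; apply (mcs_closed (H := [s ≡ t; F⟨s⟩])).
- intros B [<-|[<-|[]]]; assumption.
- apply (pf_leibniz (s := s)); apply pf_hyp; [|right]; now left.
Qed.

Lemma mcs_eq_sym G (M : mcs G) (s t : tm G ty0) :
  (M ⊨ s ≡ t) -> (M ⊨ t ≡ s).
Proof.
intros E; assert (K : M ⊨ (v0 ≡ wk s)⟨t⟩); [|cbn in K; rewrite tsub_inst_wk in K; exact K].
apply (mcs_leibniz E); cbn; rewrite tsub_inst_wk; apply mcs_refl.
Qed.

Lemma mcs_eq_trans G (M : mcs G) (s t u : tm G ty0) :
  (M ⊨ s ≡ t) -> (M ⊨ t ≡ u) -> (M ⊨ s ≡ u).
Proof.
intros E E'; assert (K : M ⊨ (wk s ≡ v0)⟨u⟩);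
  [|cbn in K; rewrite tsub_inst_wk in K; exact K].
apply (mcs_leibniz E'); cbn; rewrite tsub_inst_wk; exact E.
Qed.

Lemma mcs_Eq G (M : mcs G) (s t : tm G ty0) :
  (M ⊨ s ≡ t) <-> eqv M s t.
Proof.
split; [intros E r|intros E; exact (E (Var vz))].
assert (K : M ⊨ (wk (tsub (inst s) r) ≡ r)⟨t⟩);
  [|cbn in K; rewrite tsub_inst_wk in K; exact K].
apply (mcs_leibniz E); cbn; rewrite tsub_inst_wk; apply mcs_refl.
Qed.

Lemma eqv_Equivalence G (M : mcs G) A : Equivalence (@eqv G M A).
Proof.
split.
- intros s r; apply mcs_refl.
- intros s t E r; apply (mcs_eq_sym (E r)).
- intros s t u E E' r; apply (mcs_eq_trans (E r) (E' r)).
Qed.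
#[export] Existing Instance eqv_Equivalence.

(** The quantification over all contexts [r] gives both congruences: the argument, and then the
    function, is absorbed into the context. *)
Lemma eqv_App G (M : mcs G) A B :
  Proper (@eqv G M (A ⇒ B) ==> @eqv G M A ==> @eqv G M B) (@App G A B).
Proof.
intros f g E a b E'; transitivity (g · a); intros r.
- specialize (E (tsub (scons (v0 · wk a) (@shift G _)) r)).
  rewrite !tsub_comp, !scomp_scons in E; cbn [tsub] in E; rewrite !tsub_inst_wk in E.
  exact E.
- specialize (E' (tsub (scons (wk g · v0) (@shift G _)) r)).
  rewrite !tsub_comp, !scomp_scons in E'; cbn [tsub] in E'; rewrite !tsub_inst_wk in E'.
  exact E'.
Qed.
#[export] Existing Instance eqv_App.

(** The weak extensionality rule applies since an axiom is derived without hypotheses. Its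
    quantifier-free premise is taken to be 0 = 0. *)
Lemma eqv_ax G (M : mcs G) A (s t : tm G A) :
  T_M (eqt s t) -> eqv M s t.
Proof.
intros E r; apply mcs_prov.
apply (pf_ImpE (A := num 0 ≡ num 0)); [|apply pf_refl].
apply (@pf_ext T_Mplus G [] A ty0); [constructor|].
apply pf_ImpI, pf_ax, ax_base, E.
Qed.

Lemma eqv_lam G (M : mcs G) A B (t : tm (A :: G) B) a :
  eqv M (lam t · a) (tsub (inst a) t).
Proof.
dependent induction t.
- dependent destruction v; cbn.
  + rewrite (eqv_ax M (ax_S _ _ _)); apply eqv_ax, ax_K.
  + apply eqv_ax, ax_K.
- apply eqv_ax, ax_K.
- cbn [lam]; destruct (strengthen (t1 · t2)) as [t'|] eqn:E.
  + rewrite (wk_strengthen E), tsub_inst_wk; apply eqv_ax, ax_K.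
  + rewrite (eqv_ax M (ax_S _ _ _)), IHt1, IHt2; reflexivity.
Qed.

(** * Unfolding of the arithmetical constants *)

Lemma tsub_num G D (s : sub G D) k : tsub s (num k) = num k.
Proof. induction k; cbn; congruence. Qed.

#[global] Opaque lam wk.

Lemma tsub_Con G D (s : sub G D) A (c : con A) : tsub s (Con c) = Con c.
Proof. reflexivity. Qed.

(** With separate equations for the subterms the lemma can be applied while the right-hand side is
    still an existential variable, so that [tsub_nf] builds the normal form bottom up without
    rewriting. The later lemmas ending in [_eq] have this form for the same reason. *)
Lemma tsub_App G D (s : sub G D) A B (f : tm G (A ⇒ B)) a f' a' :
  tsub s f = f' -> tsub s a = a' -> tsub s (f · a) = f' · a'.
Proof. intros <- <-; reflexivity. Qed.

Lemma tsub_suc_eq G D (s : sub G D) n n' : tsub s n = n' -> tsub s (suc n) = suc n'.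
Proof. intros <-; reflexivity. Qed.

Lemma tsub_lam_eq G D (s : sub G D) A B (t : tm (A :: G) B) t' :
  tsub (up s) t = t' -> tsub s (lam t) = lam t'.
Proof. intros <-; apply tsub_lam. Qed.

Lemma wk_eq G B A (t t' : tm G A) u : t = t' -> wk (B := B) t' = u -> wk t = u.
Proof. intros -> E; exact E. Qed.

Lemma tsub_up_wk_eq G D B A (t : tm G A) t' (s : sub G D) u :
  tsub s t = t' -> wk (B := B) t' = u -> tsub (up s) (wk t) = u.
Proof. intros <- <-; apply tsub_up_wk. Qed.

(** Nested abstractions are contracted by one simultaneous substitution, so that arguments are not
    weakened and instantiated back one at a time. *)
Lemma eqv_lam2 G (M : mcs G) A B C (t : tm (B :: A :: G) C) a b :
  eqv M (lam (lam t) · a · b) (tsub (scons b (inst a)) t).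
Proof.
rewrite (eqv_lam M (lam t) a), tsub_lam, eqv_lam, tsub_comp.
replace (scomp _ _) with (scons b (inst a)); [reflexivity|].
apply sub_ext; intros D v; dependent destruction v; [reflexivity|].
symmetry; apply tsub_inst_wk.
Qed.

Lemma eqv_lam3 G (M : mcs G) A B C D (t : tm (C :: B :: A :: G) D) a b c :
  eqv M (lam (lam (lam t)) · a · b · c) (tsub (scons c (scons b (inst a))) t).
Proof.
rewrite (eqv_lam2 M (lam t) a b), tsub_lam, eqv_lam, tsub_comp.
replace (scomp _ _) with (scons c (scons b (inst a))); [reflexivity|].
apply sub_ext; intros E v; dependent destruction v; [reflexivity|].
symmetry; apply tsub_inst_wk.
Qed.

Lemma eqv_lam4 G (M : mcs G) A B C D E (t : tm (D :: C :: B :: A :: G) E) a b c d :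
  eqv M (lam (lam (lam (lam t))) · a · b · c · d)
        (tsub (scons d (scons c (scons b (inst a)))) t).
Proof.
rewrite (eqv_lam3 M (lam t) a b c), tsub_lam, eqv_lam, tsub_comp.
replace (scomp _ _) with (scons d (scons c (scons b (inst a)))); [reflexivity|].
apply sub_ext; intros F v; dependent destruction v; [reflexivity|].
symmetry; apply tsub_inst_wk.
Qed.

Lemma eqv_eq G (M : mcs G) A (s t u : tm G A) : eqv M s t -> t = u -> eqv M s u.
Proof. intros E <-; exact E. Qed.

#[export] Instance eqv_suc G (M : mcs G) :
  Proper (@eqv G M ty0 ==> @eqv G M ty0) (@suc G).
Proof. intros m n E; unfold suc; now rewrite E. Qed.

Create HintDb tsub_db.

Arguments shift {G B} A v /.
Arguments inst {G B} t A v /.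
Arguments up {G D B} s A v /.
Arguments scons {G D B} t s A !v /.

Ltac wk_core t := lazymatch t with wk ?s => wk_core s | _ => t end.

(* Constants are recognised by syntactic matching: [rewrite] would try to
   unify distinct constants by unfolding them. *)
Ltac tsub_nf :=
  lazymatch goal with
  | |- tsub _ (suc _) = _ => apply tsub_suc_eq; tsub_nf
  | |- tsub _ (num _) = _ => apply tsub_num
  | |- tsub _ (_ · _) = _ => apply tsub_App; tsub_nf
  | |- tsub _ (lam _) = _ => apply tsub_lam_eq; tsub_nf
  | |- tsub _ (Con _) = _ => apply tsub_Con
  | |- tsub _ (Var _) = _ =>
      cbn [tsub scons up inst shift];
      lazymatch goal with |- wk _ = _ => tsub_nf | _ => reflexivity end
  | |- tsub (inst _) (wk _) = _ => apply tsub_inst_wk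
  | |- tsub (scons _ _) (wk _) = _ => etransitivity; [apply tsub_scons_wk|tsub_nf]
  | |- tsub (up _) (wk _) = _ => eapply tsub_up_wk_eq; [tsub_nf|tsub_nf]
  | |- tsub (@shift _ _) (wk _) = _ => etransitivity; [apply tsub_shift|tsub_nf]
  | |- wk ?t = _ =>
      let c := wk_core t in
      tryif is_var c then reflexivity
      else lazymatch t with
           | wk _ => eapply wk_eq; [tsub_nf|tsub_nf]
           | _ => rewrite <- tsub_shift; tsub_nf
           end
  | |- _ => solve [auto 1 with tsub_db nocore | apply tsub_shift | reflexivity]
  end.

Ltac unfold_eqv :=
  unfold rec;
  lazymatch goal with
  | |- eqv _ (lam (lam (lam (lam _))) · _ · _ · _ · _) _ => eapply eqv_eq; [apply eqv_lam4|]
  | |- eqv _ (lam (lam (lam _)) · _ · _ · _) _ => eapply eqv_eq; [apply eqv_lam3|]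
  | |- eqv _ (lam (lam _) · _ · _) _ => eapply eqv_eq; [apply eqv_lam2|]
  | |- eqv _ (lam _ · _) _ => eapply eqv_eq; [apply eqv_lam|]
  end; tsub_nf.

(** The pattern for all constants that follow: stability of the closed term under substitution, then
    one unfolding equation, after which the constant is opaque and known only through that
    equation. *)
Lemma tsub_tPlus G D (s : sub G D) : tsub s tPlus = tPlus.
Proof. unfold tPlus, rec; tsub_nf. Qed.
#[export] Hint Extern 1 (tsub _ tPlus = _) => apply tsub_tPlus : tsub_db.

Lemma plus_rec G (M : mcs G) m n : eqv M (m ⊕ n) (rec n m (λ ty0, λ ty0, suc v1)).
Proof. unfold tPlus; unfold_eqv. Qed.
#[global] Opaque tPlus.

Lemma tsub_tPred G D (s : sub G D) : tsub s tPred = tPred.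
Proof. unfold tPred, rec; tsub_nf. Qed.
#[export] Hint Extern 1 (tsub _ tPred = _) => apply tsub_tPred : tsub_db.

Lemma pred_rec G (M : mcs G) n : eqv M (tPred · n) (rec n (num 0) (λ ty0, λ ty0, v0)).
Proof. unfold tPred; unfold_eqv. Qed.
#[global] Opaque tPred.

Lemma tsub_tMonus G D (s : sub G D) : tsub s tMonus = tMonus.
Proof. unfold tMonus, rec; tsub_nf. Qed.
#[export] Hint Extern 1 (tsub _ tMonus = _) => apply tsub_tMonus : tsub_db.

Lemma monus_rec G (M : mcs G) m n : eqv M (m ∸ n) (rec n m (λ ty0, λ ty0, tPred · v1)).
Proof. unfold tMonus; unfold_eqv. Qed.
#[global] Opaque tMonus.

Lemma tsub_tDbl G D (s : sub G D) : tsub s tDbl = tDbl.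
Proof. unfold tDbl, rec; tsub_nf. Qed.
#[export] Hint Extern 1 (tsub _ tDbl = _) => apply tsub_tDbl : tsub_db.

Lemma dbl_plus G (M : mcs G) n : eqv M (tDbl · n) (n ⊕ n).
Proof. unfold tDbl; unfold_eqv. Qed.
#[global] Opaque tDbl.

Lemma tsub_tSg G D (s : sub G D) : tsub s tSg = tSg.
Proof. unfold tSg, rec; tsub_nf. Qed.
#[export] Hint Extern 1 (tsub _ tSg = _) => apply tsub_tSg : tsub_db.

Lemma sg_monus G (M : mcs G) n : eqv M (tSg · n) (num 1 ∸ (num 1 ∸ n)).
Proof. unfold tSg; unfold_eqv. Qed.
#[global] Opaque tSg.

Lemma tsub_tHalf G D (s : sub G D) : tsub s tHalf = tHalf.
Proof. unfold tHalf, rec; tsub_nf. Qed.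
#[export] Hint Extern 1 (tsub _ tHalf = _) => apply tsub_tHalf : tsub_db.

Lemma half_rec G (M : mcs G) n :
  eqv M (tHalf · n) (rec n (num 0) (λ ty0, λ ty0, v0 ∸ v1)).
Proof. unfold tHalf; unfold_eqv. Qed.
#[global] Opaque tHalf.

Lemma tsub_tCond G D (s : sub G D) : tsub s tCond = tCond.
Proof. unfold tCond, rec; tsub_nf. Qed.
#[export] Hint Extern 1 (tsub _ tCond = _) => apply tsub_tCond : tsub_db.

Lemma cond_rec G (M : mcs G) c a b :
  eqv M (tCond · c · a · b) (rec c a (λ ty0, λ ty0, wk (wk b))).
Proof. unfold tCond; unfold_eqv. Qed.
#[global] Opaque tCond.

Lemma tsub_tIPos G D (s : sub G D) : tsub s tIPos = tIPos.
Proof. unfold tIPos, rec; tsub_nf. Qed.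
#[export] Hint Extern 1 (tsub _ tIPos = _) => apply tsub_tIPos : tsub_db.

Lemma ipos_cond G (M : mcs G) n :
  eqv M (tIPos · n) (tCond · (n ∸ tDbl · (tHalf · n)) · (tHalf · n) · num 0).
Proof. unfold tIPos; unfold_eqv. Qed.
#[global] Opaque tIPos.

Lemma tsub_tINeg G D (s : sub G D) : tsub s tINeg = tINeg.
Proof. unfold tINeg, rec; tsub_nf. Qed.
#[export] Hint Extern 1 (tsub _ tINeg = _) => apply tsub_tINeg : tsub_db.

Lemma ineg_cond G (M : mcs G) n :
  eqv M (tINeg · n) (tCond · (n ∸ tDbl · (tHalf · n)) · num 0 · suc (tHalf · n)).
Proof. unfold tINeg; unfold_eqv. Qed.
#[global] Opaque tINeg.

Lemma tsub_tICode G D (s : sub G D) : tsub s tICode = tICode.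
Proof. unfold tICode, rec; tsub_nf. Qed.
#[export] Hint Extern 1 (tsub _ tICode = _) => apply tsub_tICode : tsub_db.

Lemma icode_plus G (M : mcs G) p q :
  eqv M (tICode · p · q) (tDbl · (p ∸ q) ⊕ tPred · (tDbl · (q ∸ p))).
Proof. unfold tICode; unfold_eqv. Qed.
#[global] Opaque tICode.

Lemma tsub_tDPos G D (s : sub G D) : tsub s tDPos = tDPos.
Proof. unfold tDPos, rec; tsub_nf. Qed.
#[export] Hint Extern 1 (tsub _ tDPos = _) => apply tsub_tDPos : tsub_db.

Lemma dpos_monus G (M : mcs G) n : eqv M (tDPos · n) (n ∸ tDbl · (n ∸ num 1)).
Proof. unfold tDPos; unfold_eqv. Qed.
#[global] Opaque tDPos.

Lemma tsub_tDNeg G D (s : sub G D) : tsub s tDNeg = tDNeg.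
Proof. unfold tDNeg, rec; tsub_nf. Qed.
#[export] Hint Extern 1 (tsub _ tDNeg = _) => apply tsub_tDNeg : tsub_db.

Lemma dneg_sg G (M : mcs G) n : eqv M (tDNeg · n) (tSg · (n ∸ num 1)).
Proof. unfold tDNeg; unfold_eqv. Qed.
#[global] Opaque tDNeg.

Lemma tsub_tPos G D (s : sub G D) : tsub s tPos = tPos.
Proof. unfold tPos, rec; tsub_nf. Qed.
#[export] Hint Extern 1 (tsub _ tPos = _) => apply tsub_tPos : tsub_db.

Lemma pos_rec G (M : mcs G) g n :
  eqv M (tPos · g · n) (rec n (tIPos · (g · num 0))
    (λ ty0, λ ty0, tDbl · v1 ⊕ tDPos · (wk (wk g) · suc v0))).
Proof. unfold tPos; unfold_eqv. Qed.
#[global] Opaque tPos.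

Lemma tsub_tNeg G D (s : sub G D) : tsub s tNeg = tNeg.
Proof. unfold tNeg, rec; tsub_nf. Qed.
#[export] Hint Extern 1 (tsub _ tNeg = _) => apply tsub_tNeg : tsub_db.

Lemma neg_rec G (M : mcs G) g n :
  eqv M (tNeg · g · n) (rec n (tINeg · (g · num 0))
    (λ ty0, λ ty0, tDbl · v1 ⊕ tDNeg · (wk (wk g) · suc v0))).
Proof. unfold tNeg; unfold_eqv. Qed.
#[global] Opaque tNeg.

Lemma tsub_tNat G D (s : sub G D) : tsub s tNat = tNat.
Proof. unfold tNat, rec; tsub_nf. Qed.
#[export] Hint Extern 1 (tsub _ tNat = _) => apply tsub_tNat : tsub_db.

Lemma nat_cond G (M : mcs G) m n :
  eqv M (tNat · m · n) (tCond · n · (tDbl · m) · num 0).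
Proof. unfold tNat; unfold_eqv. Qed.
#[global] Opaque tNat.

Lemma tsub_tRem G D (s : sub G D) : tsub s tRem = tRem.
Proof. unfold tRem, rec; tsub_nf. Qed.
#[export] Hint Extern 1 (tsub _ tRem = _) => apply tsub_tRem : tsub_db.

Lemma rem_rec G (M : mcs G) k n :
  eqv M (tRem · k · n) (rec n (tSg · k)
    (λ ty0, λ ty0, tCond · (tDbl · v1 ∸ wk (wk k)) · (tDbl · v1)
                         · (tDbl · v1 ∸ suc (wk (wk k))))).
Proof. unfold tRem; unfold_eqv. Qed.
#[global] Opaque tRem.

Lemma tsub_tInv G D (s : sub G D) : tsub s tInv = tInv.
Proof. unfold tInv, rec; tsub_nf. Qed.
#[export] Hint Extern 1 (tsub _ tInv = _) => apply tsub_tInv : tsub_db.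

Lemma inv_rec G (M : mcs G) k n :
  eqv M (tInv · k · n) (rec n (tDbl · (num 1 ∸ k))
    (λ ty0, λ ty0, tSg · (tDbl · (tRem · wk (wk k) · v0) ∸ wk (wk k)))).
Proof. unfold tInv; unfold_eqv. Qed.
#[global] Opaque tInv.

Lemma tsub_tRound G D (s : sub G D) : tsub s tRound = tRound.
Proof. unfold tRound, rec; tsub_nf. Qed.
#[export] Hint Extern 1 (tsub _ tRound = _) => apply tsub_tRound : tsub_db.

Lemma round_half G (M : mcs G) n :
  eqv M (tRound · n) (tHalf · (tHalf · (n ⊕ num 2))).
Proof. unfold tRound; unfold_eqv. Qed.
#[global] Opaque tRound.

Lemma tsub_t8 G D (s : sub G D) : tsub s t8 = t8.
Proof. unfold t8, rec; tsub_nf. Qed.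
#[export] Hint Extern 1 (tsub _ t8 = _) => apply tsub_t8 : tsub_db.

Lemma t8_dbl G (M : mcs G) n : eqv M (t8 · n) (tDbl · (tDbl · (tDbl · n))).
Proof. unfold t8; unfold_eqv. Qed.
#[global] Opaque t8.

Lemma tsub_tDigit G D (s : sub G D) : tsub s tDigit = tDigit.
Proof. unfold tDigit, rec; tsub_nf. Qed.
#[export] Hint Extern 1 (tsub _ tDigit = _) => apply tsub_tDigit : tsub_db.

Lemma digit_sg G (M : mcs G) p q n c :
  eqv M (tDigit · p · q · n · c)
    (tSg · ((p · suc (suc (suc n)) ⊕ t8 · (tINeg · c))
             ∸ (q · suc (suc (suc n)) ⊕ t8 · (tIPos · c) ⊕ num 2))
     ⊕ tDbl · (tSg · ((q · suc (suc (suc n)) ⊕ t8 · (tIPos · c))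
             ∸ (p · suc (suc (suc n)) ⊕ t8 · (tINeg · c) ⊕ num 2)))).
Proof. unfold tDigit; unfold_eqv. Qed.
#[global] Opaque tDigit.

Lemma tsub_tPart G D (s : sub G D) : tsub s tPart = tPart.
Proof. unfold tPart, rec; tsub_nf. Qed.
#[export] Hint Extern 1 (tsub _ tPart = _) => apply tsub_tPart : tsub_db.

Lemma part_rec G (M : mcs G) p q n :
  eqv M (tPart · p · q · n) (rec n
    (tICode · (tRound · (p · num 2 ∸ q · num 2)) · (tRound · (q · num 2 ∸ p · num 2)))
    (λ ty0, λ ty0,
      tICode · (tDbl · (tIPos · v1) ⊕ tDPos · (tDigit · wk (wk p) · wk (wk q) · v0 · v1))
             · (tDbl · (tINeg · v1) ⊕ tDNeg · (tDigit · wk (wk p) · wk (wk q) · v0 · v1)))).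
Proof. unfold tPart; unfold_eqv. Qed.
#[global] Opaque tPart.

Lemma tsub_tConv G D (s : sub G D) : tsub s tConv = tConv.
Proof. unfold tConv, rec; tsub_nf. Qed.
#[export] Hint Extern 1 (tsub _ tConv = _) => apply tsub_tConv : tsub_db.

Lemma conv_rec G (M : mcs G) p q n :
  eqv M (tConv · p · q · n) (rec n (tPart · p · q · num 0)
    (λ ty0, λ ty0, tDigit · wk (wk p) · wk (wk q) · v0
                     · (tPart · wk (wk p) · wk (wk q) · v0))).
Proof. unfold tConv; unfold_eqv. Qed.
#[global] Opaque tConv.

Lemma tsub_tAddR G D (s : sub G D) : tsub s tAddR = tAddR.
Proof. unfold tAddR, rec; tsub_nf. Qed.
#[export] Hint Extern 1 (tsub _ tAddR = _) => apply tsub_tAddR : tsub_db.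

Lemma addR_conv G (M : mcs G) x y :
  eqv M (x +R y) (tConv · (λ ty0, tPos · wk x · v0 ⊕ tPos · wk y · v0)
                        · (λ ty0, tNeg · wk x · v0 ⊕ tNeg · wk y · v0)).
Proof. unfold tAddR; unfold_eqv. Qed.
#[global] Opaque tAddR.

(** * Formal arithmetic *)

Lemma fsub_Eq_eq G D (s : sub G D) m n m' n' :
  tsub s m = m' -> tsub s n = n' -> fsub (m ≡ n) s = (m' ≡ n').
Proof. intros <- <-; reflexivity. Qed.

Lemma fsub_leN_eq G D (s : sub G D) m n m' n' :
  tsub s m = m' -> tsub s n = n' -> fsub (leN m n) s = leN m' n'.
Proof. intros <- <-; reflexivity. Qed.

Lemma fsub_And_eq G D (s : sub G D) F F' E E' :
  fsub F s = E -> fsub F' s = E' -> fsub (F ⊓ F') s = (E ⊓ E').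
Proof. intros <- <-; reflexivity. Qed.

Lemma fsub_Or_eq G D (s : sub G D) F F' E E' :
  fsub F s = E -> fsub F' s = E' -> fsub (F ⊔ F') s = (E ⊔ E').
Proof. intros <- <-; reflexivity. Qed.

Lemma fsub_Imp_eq G D (s : sub G D) F F' E E' :
  fsub F s = E -> fsub F' s = E' -> fsub (F ⟶ F') s = (E ⟶ E').
Proof. intros <- <-; reflexivity. Qed.

Lemma fsub_All_eq G D (s : sub G D) A (F : fm (A :: G)) F' :
  fsub F (up s) = F' -> fsub (All A F) s = All A F'.
Proof. intros <-; reflexivity. Qed.

Lemma fsub_Ex_eq G D (s : sub G D) A (F : fm (A :: G)) F' :
  fsub F (up s) = F' -> fsub (Ex A F) s = Ex A F'.
Proof. intros <-; reflexivity. Qed.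

(** The relations on reals are convertible to one numerical quantifier over such an instance.
    Collection needs the instances, which are bounded formulas, separated from the quantifier. *)
Definition leR_at G (x y : tm G ty1) (n : tm G ty0) : fm G :=
  leN (tPos · x · n ⊕ tNeg · y · n) (tPos · y · n ⊕ tNeg · x · n ⊕ num 2).

Definition eqR_at G (x y : tm G ty1) (n : tm G ty0) : fm G := leR_at x y n ⊓ leR_at y x n.

Definition ltR_at G (x y : tm G ty1) (n : tm G ty0) : fm G :=
  ltN (tPos · x · n ⊕ tNeg · y · n ⊕ num 2) (tPos · y · n ⊕ tNeg · x · n).

Lemma fsub_leR_at_eq G D (s : sub G D) x y n x' y' n' :
  tsub s x = x' -> tsub s y = y' -> tsub s n = n' ->
  fsub (leR_at x y n) s = leR_at x' y' n'.
Proof. intros <- <- <-; apply fsub_leN_eq; tsub_nf. Qed.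

Lemma fsub_eqR_at_eq G D (s : sub G D) x y n x' y' n' :
  tsub s x = x' -> tsub s y = y' -> tsub s n = n' ->
  fsub (eqR_at x y n) s = eqR_at x' y' n'.
Proof. intros; apply fsub_And_eq; now apply fsub_leR_at_eq. Qed.

Lemma fsub_ltR_at_eq G D (s : sub G D) x y n x' y' n' :
  tsub s x = x' -> tsub s y = y' -> tsub s n = n' ->
  fsub (ltR_at x y n) s = ltR_at x' y' n'.
Proof. intros <- <- <-; apply fsub_leN_eq; tsub_nf. Qed.

Lemma fsub_eqR_eq G D (s : sub G D) x y x' y' :
  tsub s x = x' -> tsub s y = y' -> fsub (x =R y) s = (x' =R y').
Proof.
intros <- <-; change (fsub (All ty0 (eqR_at (wk x) (wk y) v0)) s
                     = All ty0 (eqR_at (wk (tsub s x)) (wk (tsub s y)) v0)).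
apply fsub_All_eq, fsub_eqR_at_eq; (reflexivity || apply tsub_up_wk).
Qed.

Lemma fsub_ltR_eq G D (s : sub G D) x y x' y' :
  tsub s x = x' -> tsub s y = y' -> fsub (x <R y) s = (x' <R y').
Proof.
intros <- <-; change (fsub (Ex ty0 (ltR_at (wk x) (wk y) v0)) s
                     = Ex ty0 (ltR_at (wk (tsub s x)) (wk (tsub s y)) v0)).
apply fsub_Ex_eq, fsub_ltR_at_eq; (reflexivity || apply tsub_up_wk).
Qed.

Lemma fsub_leR_eq G D (s : sub G D) x y x' y' :
  tsub s x = x' -> tsub s y = y' -> fsub (x ≤R y) s = (x' ≤R y').
Proof.
intros <- <-; change (fsub (All ty0 (leR_at (wk x) (wk y) v0)) s
                     = All ty0 (leR_at (wk (tsub s x)) (wk (tsub s y)) v0)).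
apply fsub_All_eq, fsub_leR_at_eq; (reflexivity || apply tsub_up_wk).
Qed.

Lemma fsub_fsub_eq G D E (F : fm G) (s : sub G D) (s' : sub D E) F' F'' :
  fsub F s = F' -> fsub F' s' = F'' -> fsub (fsub F s) s' = F''.
Proof. intros <- <-; reflexivity. Qed.

Ltac fsub_nf :=
  lazymatch goal with
  | |- fsub _ (shift2 _) = _ => unfold shift2; fsub_nf
  | |- fsub (fsub _ _) _ = _ => eapply fsub_fsub_eq; [fsub_nf|fsub_nf]
  | |- fsub (eqR_at _ _ _) _ = _ => apply fsub_eqR_at_eq; tsub_nf
  | |- fsub (ltR_at _ _ _) _ = _ => apply fsub_ltR_at_eq; tsub_nf
  | |- fsub (_ =R _) _ = _ => apply fsub_eqR_eq; tsub_nf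
  | |- fsub (_ <R _) _ = _ => apply fsub_ltR_eq; tsub_nf
  | |- fsub (_ ≤R _) _ = _ => apply fsub_leR_eq; tsub_nf
  | |- fsub (leN _ _) _ = _ => apply fsub_leN_eq; tsub_nf
  | |- fsub (_ ≡ _) _ = _ => apply fsub_Eq_eq; tsub_nf
  | |- fsub Fls _ = _ => reflexivity
  | |- fsub (_ ⊓ _) _ = _ => apply fsub_And_eq; fsub_nf
  | |- fsub (_ ⊔ _) _ = _ => apply fsub_Or_eq; fsub_nf
  | |- fsub (_ ⟶ _) _ = _ => apply fsub_Imp_eq; fsub_nf
  | |- fsub (All _ _) _ = _ => apply fsub_All_eq; fsub_nf
  | |- fsub (Ex _ _) _ = _ => apply fsub_Ex_eq; fsub_nf
  | |- fsub (ExLe _ _) _ = _ => unfold ExLe; fsub_nf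
  | |- fwk _ = _ => unfold fwk; fsub_nf
  end.

Lemma mcs_ind_nf G (M : mcs G) H (F : fm (ty0 :: G)) t F0 FS Ft :
  F⟨num 0⟩ = F0 -> fsub F (scons (suc v0) (@shift G ty0)) = FS -> F⟨t⟩ = Ft ->
  (forall B, In B H -> M ⊨ B) ->
  (M ⊨ F0) ->
  (forall M', (forall B, In B H -> M' ⊨ fwk B) -> (M' ⊨ F) -> (M' ⊨ FS)) ->
  (M ⊨ Ft).
Proof. intros <- <- <-; apply mcs_ind. Qed.

Lemma mcs_AllE_nf G (M : mcs G) A (F : fm (A :: G)) t F' :
  (M ⊨ All A F) -> F⟨t⟩ = F' -> (M ⊨ F').
Proof. intros K <-; now apply mcs_AllE. Qed.

Lemma mem_eq G (M : mcs G) F F' : (M ⊨ F) -> F = F' -> (M ⊨ F').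
Proof. intros K <-; exact K. Qed.

Tactic Notation "inst_nf" hyp(K) uconstr(t) "as" ident(K') :=
  epose proof (mcs_AllE_nf (t := t) K (ltac:(fsub_nf))) as K'.

Tactic Notation "fsub_nf" "in" hyp(K) :=
  eapply mem_eq in K; [|fsub_nf].

Ltac induct F t :=
  eapply (mcs_ind_nf (H := []) (F := F) (t := t));
  [fsub_nf|fsub_nf|fsub_nf|intros ? []| |intros M' _].

(** * Addition, truncated subtraction and the order *)

Lemma plus_0r G (M : mcs G) m : eqv M (m ⊕ num 0) m.
Proof. rewrite plus_rec; apply eqv_ax, ax_rec0. Qed.

Lemma rec_S G (M : mcs G) A n (a : tm G A) f :
  eqv M (Con (cRec A) · suc n · a · f) (f · rec n a f · n).
Proof. apply eqv_ax, ax_recS. Qed.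

Lemma plus_Sr G (M : mcs G) m n : eqv M (m ⊕ suc n) (suc (m ⊕ n)).
Proof. rewrite !plus_rec; unfold rec at 1; rewrite rec_S; unfold_eqv. Qed.

Lemma plus_0l G (M : mcs G) n : eqv M (num 0 ⊕ n) n.
Proof.
apply mcs_Eq; induct ((num 0 ⊕ v0 ≡ v0) : fm (ty0 :: G)) n; rewrite !mcs_Eq.
- apply plus_0r.
- intros IH; rewrite plus_Sr, IH; reflexivity.
Qed.

Lemma plus_Sl G (M : mcs G) m n : eqv M (suc m ⊕ n) (suc (m ⊕ n)).
Proof.
apply mcs_Eq; induct (suc (wk m) ⊕ v0 ≡ suc (wk m ⊕ v0)) n; rewrite !mcs_Eq.
- rewrite !plus_0r; reflexivity.
- intros IH; rewrite !plus_Sr, IH; reflexivity.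
Qed.

Lemma plus_comm G (M : mcs G) m n : eqv M (m ⊕ n) (n ⊕ m).
Proof.
apply mcs_Eq; induct (wk m ⊕ v0 ≡ v0 ⊕ wk m) n; rewrite !mcs_Eq.
- rewrite plus_0r, plus_0l; reflexivity.
- intros IH; rewrite plus_Sr, plus_Sl, IH; reflexivity.
Qed.

Lemma plus_assoc G (M : mcs G) m n p : eqv M (m ⊕ (n ⊕ p)) (m ⊕ n ⊕ p).
Proof.
apply mcs_Eq; induct (wk m ⊕ (wk n ⊕ v0) ≡ wk m ⊕ wk n ⊕ v0) p; rewrite !mcs_Eq.
- rewrite !plus_0r; reflexivity.
- intros IH; rewrite !plus_Sr, IH; reflexivity.
Qed.

Lemma pred_0 G (M : mcs G) : eqv M (tPred · num 0) (num 0).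
Proof. rewrite pred_rec; apply eqv_ax, ax_rec0. Qed.

Lemma pred_S G (M : mcs G) n : eqv M (tPred · suc n) n.
Proof. rewrite pred_rec; unfold rec; rewrite rec_S; unfold_eqv. Qed.

Lemma monus_0r G (M : mcs G) m : eqv M (m ∸ num 0) m.
Proof. rewrite monus_rec; apply eqv_ax, ax_rec0. Qed.

Lemma monus_Sr G (M : mcs G) m n : eqv M (m ∸ suc n) (tPred · (m ∸ n)).
Proof. rewrite !monus_rec; unfold rec at 1; rewrite rec_S; unfold_eqv. Qed.

Lemma monus_SS G (M : mcs G) m n : eqv M (suc m ∸ suc n) (m ∸ n).
Proof.
apply mcs_Eq; induct (suc (wk m) ∸ suc v0 ≡ wk m ∸ v0) n; rewrite !mcs_Eq.
- rewrite monus_Sr, !monus_0r, pred_S; reflexivity.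
- intros IH; rewrite monus_Sr, IH, monus_Sr; reflexivity.
Qed.

Lemma monus_0l G (M : mcs G) n : eqv M (num 0 ∸ n) (num 0).
Proof.
apply mcs_Eq; induct ((num 0 ∸ v0 ≡ num 0) : fm (ty0 :: G)) n; rewrite !mcs_Eq.
- apply monus_0r.
- intros IH; rewrite monus_Sr, IH; apply pred_0.
Qed.

Lemma plus_monus G (M : mcs G) m n : eqv M ((m ⊕ n) ∸ m) n.
Proof.
apply mcs_Eq; induct ((v0 ⊕ wk n) ∸ v0 ≡ wk n) m; rewrite !mcs_Eq.
- rewrite plus_0l; apply monus_0r.
- intros IH; rewrite plus_Sl, monus_SS; exact IH.
Qed.

Lemma monus_plus G (M : mcs G) m n : eqv M (m ∸ (m ⊕ n)) (num 0).
Proof.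
apply mcs_Eq; induct (v0 ∸ (v0 ⊕ wk n) ≡ num 0) m; rewrite !mcs_Eq.
- rewrite plus_0l; apply monus_0l.
- intros IH; rewrite plus_Sl, monus_SS; exact IH.
Qed.

Lemma zero_or_suc G (M : mcs G) n : eqv M n (num 0) \/ eqv M n (suc (tPred · n)).
Proof.
rewrite <- !mcs_Eq, <- mcs_Or.
induct ((v0 ≡ num 0 ⊔ v0 ≡ suc (tPred · v0)) : fm (ty0 :: G)) n; rewrite !mcs_Or, !mcs_Eq.
- left; reflexivity.
- right; rewrite pred_S; reflexivity.
Qed.

(** The source of all order facts: complements, dichotomy and antisymmetry. The disjuncts overlap at
    m = n, and this is where the induction passes from the first to the second. *)
Lemma monus_total G (M : mcs G) m n :
  eqv M m (n ⊕ (m ∸ n)) \/ eqv M n (m ⊕ (n ∸ m)).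
Proof.
rewrite <- !mcs_Eq, <- mcs_Or.
induct (wk m ≡ v0 ⊕ (wk m ∸ v0) ⊔ v0 ≡ wk m ⊕ (v0 ∸ wk m)) n; rewrite !mcs_Or, !mcs_Eq.
- left; rewrite plus_0l, monus_0r; reflexivity.
- assert (R : forall k, eqv M' v0 (wk m ⊕ k) -> eqv M' (suc v0) (wk m ⊕ (suc v0 ∸ wk m))).
  { intros k E.
    assert (E' : eqv M' (suc v0) (wk m ⊕ suc k)) by (rewrite plus_Sr, E at 1; reflexivity).
    rewrite E' at 2; rewrite plus_monus; exact E'. }
  intros [E|E]; [|right; exact (R _ E)].
  destruct (zero_or_suc M' (wk m ∸ v0)) as [Z|S].
  + right; apply (R (num 0)).
    rewrite Z, plus_0r in E; rewrite E, plus_0r; reflexivity.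
  + left; rewrite monus_Sr, plus_Sl, <- plus_Sr, <- S; exact E.
Qed.

Definition le G (M : mcs G) (m n : tm G ty0) : Prop := eqv M (m ∸ n) (num 0).

#[export] Instance eqv_le G (M : mcs G) :
  Proper (@eqv G M ty0 ==> @eqv G M ty0 ==> iff) (@le G M).
Proof. intros m n E m' n' E'; unfold le; now rewrite E, E'. Qed.

Lemma mcs_leN G (M : mcs G) m n : (M ⊨ leN m n) <-> le M m n.
Proof. apply mcs_Eq. Qed.

Lemma le_plus G (M : mcs G) m n k : eqv M n (m ⊕ k) -> le M m n.
Proof. intros E; rewrite E; apply monus_plus. Qed.

Lemma le_monus G (M : mcs G) m n : le M m n -> eqv M n (m ⊕ (n ∸ m)).
Proof.
unfold le; intros L; destruct (monus_total M m n) as [E|E]; [|exact E].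
assert (E' : eqv M n (m ⊕ num 0)) by (rewrite L, plus_0r in E; rewrite plus_0r, E; reflexivity).
rewrite E' at 2; rewrite plus_monus; exact E'.
Qed.

Lemma le_total G (M : mcs G) m n : le M m n \/ le M (suc n) m.
Proof.
destruct (monus_total M m n) as [E|E]; [|left; exact (le_plus E)].
destruct (zero_or_suc M (m ∸ n)) as [Z|S]; [left; exact Z|right].
apply (le_plus (k := tPred · (m ∸ n))); rewrite plus_Sl, <- plus_Sr, <- S; exact E.
Qed.

Lemma plus_cancel G (M : mcs G) p m n : eqv M (p ⊕ m) (p ⊕ n) -> eqv M m n.
Proof. intros E; rewrite <- (plus_monus M p m), E; apply plus_monus. Qed.

Lemma le_refl G (M : mcs G) m : le M m m.
Proof. apply (le_plus (k := num 0)); symmetry; apply plus_0r. Qed.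

Lemma le_trans G (M : mcs G) m n p : le M m n -> le M n p -> le M m p.
Proof.
intros L L'; apply (le_plus (k := (n ∸ m) ⊕ (p ∸ n))).
rewrite plus_assoc, <- (le_monus L); apply le_monus, L'.
Qed.

Lemma le_plus2 G (M : mcs G) m n m' n' :
  le M m n -> le M m' n' -> le M (m ⊕ m') (n ⊕ n').
Proof.
intros L L'; apply (le_plus (k := (n ∸ m) ⊕ (n' ∸ m'))).
rewrite (le_monus L) at 1; rewrite (le_monus L') at 1.
rewrite <- !plus_assoc; apply eqv_App; [reflexivity|].
rewrite !plus_assoc; apply eqv_App; [|reflexivity].
apply eqv_App; [reflexivity|apply plus_comm].
Qed.

Lemma not_suc_le G (M : mcs G) m : ~ le M (suc m) m.
Proof.
intros L; apply le_monus in L; revert L; set (k := m ∸ suc m); intros L.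
assert (E : eqv M (m ⊕ suc k) (m ⊕ num 0))
  by (rewrite plus_Sr, <- plus_Sl, plus_0r, <- L; reflexivity).
apply plus_cancel in E.
assert (K : M ⊨ ¬ (suc k ≡ num 0)) by apply mcs_ax, ax_succ_nz.
rewrite mcs_Not, mcs_Eq in K; exact (K E).
Qed.

Lemma le_antisym G (M : mcs G) m n : le M m n -> le M n m -> eqv M m n.
Proof.
intros L L'; pose proof (le_monus L) as E; rewrite E.
destruct (zero_or_suc M (n ∸ m)) as [Z|S]; [rewrite Z, plus_0r; reflexivity|].
exfalso; apply (not_suc_le (M := M) (m := m)), (le_trans (n := n)); [|exact L'].
apply (le_plus (k := tPred · (n ∸ m))); rewrite plus_Sl, <- plus_Sr, <- S; exact E.
Qed.

Lemma eqv_le_le G (M : mcs G) m n : eqv M m n -> le M m n /\ le M n m.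
Proof. intros E; split; rewrite E; apply le_refl. Qed.

(** * Linear arithmetic *)

Inductive lexp : Type :=
| LAtom : nat -> lexp
| LNum : nat -> lexp
| LSuc : lexp -> lexp
| LPlus : lexp -> lexp -> lexp
| LDbl : lexp -> lexp.

Fixpoint ldenote G (ts : list (tm G ty0)) (e : lexp) : tm G ty0 :=
  match e with
  | LAtom i => nth i ts (num 0)
  | LNum k => num k
  | LSuc e => suc (ldenote ts e)
  | LPlus e e' => ldenote ts e ⊕ ldenote ts e'
  | LDbl e => tDbl · ldenote ts e
  end.

Fixpoint vadd (v w : list nat) : list nat :=
  match v, w with
  | [], _ => w
  | _, [] => v
  | a :: v, b :: w => a + b :: vadd v w
  end.

Fixpoint vmul (c : nat) (v : list nat) : list nat :=
  match c with
  | 0 => []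
  | S c => vadd v (vmul c v)
  end.

(** Atoms denote natural numbers, so coefficientwise comparison implies the inequality for all their
    values. Missing positions count as 0. *)
Fixpoint vle (v w : list nat) : bool :=
  match v, w with
  | [], _ => true
  | a :: v, [] => Nat.eqb a 0 && vle v []
  | a :: v, b :: w => Nat.leb a b && vle v w
  end.

(* Position 0 holds the constant, position i + 1 the coefficient of atom i. *)
Fixpoint lnorm (e : lexp) : list nat :=
  match e with
  | LAtom i => repeat 0 (S i) ++ [1]
  | LNum k => [k]
  | LSuc e => vadd [1] (lnorm e)
  | LPlus e e' => vadd (lnorm e) (lnorm e')
  | LDbl e => vadd (lnorm e) (lnorm e)
  end.

Fixpoint tmul G (c : nat) (t : tm G ty0) : tm G ty0 :=
  match c with
  | 0 => num 0
  | S c => t ⊕ tmul c t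
  end.

Fixpoint vdenote G (ts : list (tm G ty0)) (v : list nat) : tm G ty0 :=
  match v with
  | [] => num 0
  | c :: v => tmul c (hd (num 0) ts) ⊕ vdenote (tl ts) v
  end.

Lemma tmul_add G (M : mcs G) a b t : eqv M (tmul (a + b) t) (tmul a t ⊕ tmul b t).
Proof.
induction a; cbn [tmul Nat.add]; [rewrite plus_0l; reflexivity|].
rewrite IHa, plus_assoc; reflexivity.
Qed.

Lemma tmul_le G (M : mcs G) a b t : a <= b -> le M (tmul a t) (tmul b t).
Proof.
intros L; apply (le_plus (k := tmul (b - a) t)).
rewrite <- tmul_add; replace (a + (b - a)) with b; [reflexivity|].
now rewrite Nat.add_comm, Nat.sub_add.
Qed.

Lemma le_0 G (M : mcs G) t : le M (num 0) t.
Proof. apply (le_plus (k := t)); symmetry; apply plus_0l. Qed.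

Lemma plus_swap G (M : mcs G) a b c d : eqv M (a ⊕ b ⊕ (c ⊕ d)) (a ⊕ c ⊕ (b ⊕ d)).
Proof.
rewrite <- !plus_assoc; apply eqv_App; [reflexivity|].
rewrite !plus_assoc; apply eqv_App; [|reflexivity].
apply eqv_App; [reflexivity|apply plus_comm].
Qed.

Lemma vdenote_add G (M : mcs G) v : forall w ts,
  eqv M (vdenote ts (vadd v w)) (vdenote ts v ⊕ vdenote ts w).
Proof.
induction v as [|a v IH]; intros [|b w] ts; cbn [vadd vdenote];
  rewrite ?plus_0l, ?plus_0r; try reflexivity.
rewrite tmul_add, IH; apply plus_swap.
Qed.

Lemma vdenote_repeat G (M : mcs G) n : forall ts v,
  eqv M (vdenote ts (repeat 0 n ++ v)) (vdenote (skipn n ts) v).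
Proof.
induction n as [|n IH]; intros ts v; [reflexivity|].
cbn [repeat app vdenote tmul]; rewrite plus_0l, IH.
destruct ts; [rewrite skipn_nil|]; reflexivity.
Qed.

Lemma lnorm_sound G (M : mcs G) ts e :
  eqv M (ldenote ts e) (vdenote (num 1 :: ts) (lnorm e)).
Proof.
assert (N : forall k, eqv M (num k) (tmul k (num 1))).
{ induction k; cbn [tmul]; [reflexivity|].
  change (num (S k)) with (suc (@num k G)); change (num 1) with (suc (@num 0 G)) at 1.
  rewrite plus_Sl, plus_0l, <- IHk; reflexivity. }
induction e; cbn [ldenote lnorm].
- rewrite vdenote_repeat; cbn [skipn vdenote tmul]; rewrite !plus_0r.
  revert ts; induction n; intros [|t ts]; try reflexivity; apply IHn.
- cbn [vdenote hd]; rewrite plus_0r; apply N.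
- rewrite vdenote_add, <- IHe; cbn [vdenote hd tmul].
  change (num 1) with (suc (@num 0 G)); rewrite !plus_0r, plus_Sl, plus_0l; reflexivity.
- rewrite vdenote_add, IHe1, IHe2; reflexivity.
- rewrite dbl_plus, vdenote_add, IHe; reflexivity.
Qed.

Lemma vle_sound G (M : mcs G) v : forall w ts,
  vle v w = true -> le M (vdenote ts v) (vdenote ts w).
Proof.
induction v as [|a v IH]; intros w ts; [intros _; apply le_0|].
destruct w as [|b w]; cbn [vle vdenote]; rewrite Bool.andb_true_iff; intros [E E'].
- apply Nat.eqb_eq in E as ->; cbn [tmul]; rewrite plus_0l; exact (IH [] _ E').
- apply le_plus2; [apply tmul_le, Nat.leb_le, E|apply IH, E'].
Qed.

(** The hypotheses are curried so that the proposition computes to the goal left by [lin_false]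
    after reverting, which [farkas] then closes by conversion. *)
Fixpoint hyps_denote G (M : mcs G) ts (h : list (lexp * lexp)) (P : Prop) : Prop :=
  match h with
  | [] => P
  | (e, e') :: h => le M (ldenote ts e) (ldenote ts e') -> hyps_denote M ts h P
  end.

Fixpoint combine_hyps (h : list (lexp * lexp)) (cs : list nat) : list nat * list nat :=
  match h, cs with
  | (e, e') :: h, c :: cs =>
      let (v, w) := combine_hyps h cs in
      (vadd (vmul c (lnorm e)) v, vadd (vmul c (lnorm e')) w)
  | _, _ => ([], [])
  end.

(* A Farkas certificate: the sum of the hypotheses with multiplicities [cs]
   has a left hand side exceeding its right hand side coefficientwise. *)
Definition farkas_check (h : list (lexp * lexp)) (cs : list nat) : bool :=
  let (v, w) := combine_hyps h cs in vle (vadd [1] w) v.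

Lemma vmul_le G (M : mcs G) ts c v w :
  le M (vdenote ts v) (vdenote ts w) -> le M (vdenote ts (vmul c v)) (vdenote ts (vmul c w)).
Proof.
intros L; induction c; cbn [vmul]; [apply le_refl|].
rewrite !vdenote_add; apply le_plus2; assumption.
Qed.

Lemma farkas G (M : mcs G) ts h cs :
  farkas_check h cs = true -> hyps_denote M ts h False.
Proof.
unfold farkas_check; intros E.
assert (K : forall P : Prop, (le M (vdenote (num 1 :: ts) (fst (combine_hyps h cs)))
                (vdenote (num 1 :: ts) (snd (combine_hyps h cs))) -> P) ->
  hyps_denote M ts h P).
{ clear E; revert cs; induction h as [|[e e'] h IH]; intros cs P K; cbn [hyps_denote].
  - apply K; destruct cs; apply le_refl.
  - intros L; destruct cs as [|c cs].
    + apply (IH []); intros _; apply K; apply le_refl.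
    + apply (IH cs); intros L'; apply K; cbn [combine_hyps].
      destruct (combine_hyps h cs) as [v w]; cbn [fst snd] in *.
      rewrite !vdenote_add; apply le_plus2; [|exact L'].
      apply vmul_le; rewrite <- !lnorm_sound; exact L. }
apply K; intros L; destruct (combine_hyps h cs) as [v w]; cbn [fst snd] in L.
apply vle_sound with (M := M) (ts := num 1 :: ts) in E.
apply (not_suc_le (M := M) (m := vdenote (num 1 :: ts) w)),
  (le_trans (n := vdenote (num 1 :: ts) v));
  [|exact L].
rewrite vdenote_add in E; cbn [vdenote hd tmul] in E.
change (num 1) with (suc (@num 0 G)) in E at 1; rewrite !plus_0r, plus_Sl, plus_0l in E; exact E.
Qed.

(* Fourier-Motzkin elimination; a constraint [(v, cs)] states that the linear
   form [v] is nonnegative, and [cs] are the multiplicities of the hypotheses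
   from which it was obtained. *)
Definition constraint : Type := (list Z * list Z)%type.

Fixpoint zcomb (a b : Z) (v w : list Z) : list Z :=
  match v, w with
  | [], _ => map (Z.mul b) w
  | _, [] => map (Z.mul a) v
  | x :: v, y :: w => (a * x + b * y)%Z :: zcomb a b v w
  end.

Definition fm_step (j : nat) (cs : list constraint) : list constraint :=
  let co (c : constraint) := nth j (fst c) 0%Z in
  let ps := filter (fun c => Z.ltb 0 (co c)) cs in
  let ns := filter (fun c => Z.ltb (co c) 0) cs in
  filter (fun c => Z.eqb (co c) 0) cs ++
  flat_map (fun p => map (fun n =>
    let g := Z.gcd (co p) (co n) in
    let a := (- co n / g)%Z in let b := (co p / g)%Z in
    (zcomb a b (fst p) (fst n), zcomb a b (snd p) (snd n))) ns) ps.

Definition fm_cost (j : nat) (cs : list constraint) : nat :=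
  let co (c : constraint) := nth j (fst c) 0%Z in
  length (filter (fun c => Z.ltb 0 (co c)) cs) * length (filter (fun c => Z.ltb (co c) 0) cs).

Definition fm_pick (js : list nat) (j0 : nat) (cs : list constraint) : nat :=
  snd (fold_left (fun best j => let c := fm_cost j cs in
         if Nat.ltb c (fst best) then (c, j) else best) js (fm_cost j0 cs, j0)).

Fixpoint fm_run (fuel : nat) (js : list nat) (cs : list constraint) : list constraint :=
  match fuel, js with
  | S fuel, j0 :: _ =>
      let j := fm_pick js j0 cs in
      fm_run fuel (filter (fun i => negb (Nat.eqb i j)) js) (fm_step j cs)
  | _, _ => cs
  end.

(** The search is untrusted; only its result is verified, by [farkas_check]. Nonnegativity of the
    atoms enters with an empty list of multiplicities: it is no hypothesis, and the check accounts
    for it by comparing coefficients with [vle]. *)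
Definition fm_cert (n : nat) (h : list (lexp * lexp)) : list nat :=
  let zs v := map Z.of_nat v in
  let hyps := map (fun p : nat * (lexp * lexp) => let (i, ee) := p in
      (zcomb 1 (-1) (zs (lnorm (snd ee))) (zs (lnorm (fst ee))), zs (repeat 0 i ++ [1])))
    (List.combine (seq 0 (length h)) h) in
  let atoms := map (fun i => (zs (repeat 0 i ++ [1]), [])) (seq 1 n) in
  match filter (fun c => Z.ltb (nth 0 (fst c) 0%Z) 0) (fm_run n (seq 1 n) (hyps ++ atoms)) with
  | c :: _ => map Z.to_nat (snd c)
  | [] => []
  end.

Ltac lin_index t ts :=
  lazymatch ts with
  | t :: _ => constr:(0)
  | _ :: ?ts' => let i := lin_index t ts' in constr:(S i)
  end.

Ltac lin_mem t ts :=
  lazymatch ts with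
  | t :: _ => constr:(true)
  | _ :: ?ts' => lin_mem t ts'
  | [] => constr:(false)
  end.

Ltac lin_atoms t ts :=
  lazymatch t with
  | suc ?a => lin_atoms a ts
  | num _ => ts
  | ?a ⊕ ?b => let ts' := lin_atoms a ts in lin_atoms b ts'
  | tDbl · ?a => lin_atoms a ts
  | _ => lazymatch lin_mem t ts with true => ts | false => constr:(t :: ts) end
  end.

Ltac lin_reify t ts :=
  lazymatch t with
  | suc ?a => let e := lin_reify a ts in constr:(LSuc e)
  | num ?k => constr:(LNum k)
  | ?a ⊕ ?b => let e := lin_reify a ts in let e' := lin_reify b ts in constr:(LPlus e e')
  | tDbl · ?a => let e := lin_reify a ts in constr:(LDbl e)
  | _ => let i := lin_index t ts in constr:(LAtom i)
  end.

Ltac lin_goal_atoms g ts :=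
  lazymatch g with
  | le _ ?a ?b -> ?g' =>
      let ts1 := lin_atoms a ts in let ts2 := lin_atoms b ts1 in lin_goal_atoms g' ts2
  | False => ts
  end.

Ltac lin_goal_hyps g ts :=
  lazymatch g with
  | le _ ?a ?b -> ?g' =>
      let e := lin_reify a ts in let e' := lin_reify b ts in
      let h := lin_goal_hyps g' ts in constr:((e, e') :: h)
  | False => constr:(@nil (lexp * lexp))
  end.

Ltac lin_false M G :=
  repeat match goal with
  | H : @eqv _ M ty0 _ _ |- _ => apply eqv_le_le in H; destruct H
  end;
  repeat match goal with H : le M _ _ |- _ => revert H end;
  lazymatch goal with
  | |- ?g =>
      let ts := lin_goal_atoms g (@nil (tm G ty0)) in
      let h := lin_goal_hyps g ts in
      let n := eval compute in (length ts) in
      let c := eval vm_compute in (fm_cert n h) in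
      exact (@farkas G M ts h c (eq_refl true))
  end.

(** The goal is negated through [le_total], so strictness becomes a gap of 1. Truncated differences,
    halves, signs and digits are atoms here and must be split into cases beforehand. *)
Ltac lin :=
  lazymatch goal with
  | |- @le ?G ?M ?a ?b =>
      let H := fresh in destruct (@le_total G M a b) as [H|H]; [exact H|exfalso; lin_false M G]
  | |- @eqv ?G ?M ty0 ?a ?b => apply le_antisym; lin
  | M : mcs ?G |- False => lin_false M G
  end.

(** * Real numbers *)

Lemma monus_cases G (M : mcs G) m n :
  (le M m n /\ eqv M (m ∸ n) (num 0)) \/ (le M n m /\ eqv M m (n ⊕ (m ∸ n))).
Proof.
destruct (le_total M m n) as [L|L]; [left; split; exact L|right].
assert (L' : le M n m) by lin; split; [exact L'|apply le_monus, L'].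
Qed.

Ltac monus_split m n :=
  lazymatch goal with M : mcs _ |- _ => destruct (monus_cases M m n) as [[? ?]|[? ?]] end.

Lemma sg_cases G (M : mcs G) n :
  (eqv M n (num 0) /\ eqv M (tSg · n) (num 0)) \/
  (le M (num 1) n /\ eqv M (tSg · n) (num 1)).
Proof.
pose proof (sg_monus M n).
monus_split (@num 1 G) n; monus_split (@num 1 G) (num 1 ∸ n);
  destruct (le_total M n (num 0)); solve [left; split; lin|right; split; lin].
Qed.

Lemma cond_0 G (M : mcs G) c a b : eqv M c (num 0) -> eqv M (tCond · c · a · b) a.
Proof. intros E; rewrite E, cond_rec; apply eqv_ax, ax_rec0. Qed.

Lemma cond_S G (M : mcs G) c a b : le M (num 1) c -> eqv M (tCond · c · a · b) b.
Proof.
intros L; destruct (zero_or_suc M c) as [E|E]; [exfalso; lin|].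
rewrite E, cond_rec; unfold rec; rewrite rec_S; unfold_eqv.
Qed.

Lemma half_0 G (M : mcs G) : eqv M (tHalf · num 0) (num 0).
Proof. rewrite half_rec; apply eqv_ax, ax_rec0. Qed.

Lemma half_S G (M : mcs G) n : eqv M (tHalf · suc n) (n ∸ tHalf · n).
Proof. rewrite !half_rec; unfold rec at 1; rewrite rec_S; unfold_eqv. Qed.

(** Since half (n + 1) = n - half n, each bound at n + 1 is the other bound at n; hence they are
    proved together. *)
Lemma half_bounds G (M : mcs G) n :
  le M (tDbl · (tHalf · n)) n /\ le M n (tDbl · (tHalf · n) ⊕ num 1).
Proof.
rewrite <- !mcs_leN, <- mcs_And.
induct ((leN (tDbl · (tHalf · v0)) v0
  ⊓ leN v0 (tDbl · (tHalf · v0) ⊕ num 1)) : fm (ty0 :: G)) n;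
  rewrite !mcs_And, !mcs_leN.
- pose proof (half_0 M); split; lin.
- intros [L L']; pose proof (half_S M' v0).
  monus_split (@v0 : tm (ty0 :: G) ty0) (tHalf · v0 : tm (ty0 :: G) ty0); split; lin.
Qed.

Lemma code_even G (M : mcs G) v k : eqv M v (tDbl · k) ->
  eqv M (tIPos · v) k /\ eqv M (tINeg · v) (num 0).
Proof.
intros E; destruct (half_bounds M v) as [L L'].
assert (E' : eqv M (tHalf · v) k).
{ destruct (le_total M k (tHalf · v)), (le_total M (tHalf · v) k); lin. }
pose proof (ipos_cond M v); pose proof (ineg_cond M v).
assert (Z : eqv M (v ∸ tDbl · (tHalf · v)) (num 0)).
{ monus_split v (tDbl · (tHalf · v)); lin. }
split; [rewrite ipos_cond, cond_0 by exact Z; lin|rewrite ineg_cond; exact (cond_0 _ _ Z)].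
Qed.

Lemma code_odd G (M : mcs G) v k : eqv M v (suc (tDbl · k)) ->
  eqv M (tIPos · v) (num 0) /\ eqv M (tINeg · v) (suc k).
Proof.
intros E; destruct (half_bounds M v) as [L L'].
assert (E' : eqv M (tHalf · v) k).
{ destruct (le_total M k (tHalf · v)), (le_total M (tHalf · v) k); lin. }
assert (Z : le M (num 1) (v ∸ tDbl · (tHalf · v))).
{ monus_split v (tDbl · (tHalf · v)); lin. }
split; [rewrite ipos_cond; exact (cond_S _ _ Z)|rewrite ineg_cond, cond_S by exact Z; lin].
Qed.

(** The coded integer has the value p - q, expressed by sums because truncated subtraction is opaque
    to [lin]. For p < q the code is the odd number 2 (q - p - 1) + 1. *)
Lemma icode_spec G (M : mcs G) p q :
  eqv M (tIPos · (tICode · p · q) ⊕ q) (tINeg · (tICode · p · q) ⊕ p).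
Proof.
pose proof (icode_plus M p q) as E.
destruct (le_total M q p) as [L|L].
- assert (Z : eqv M (tPred · (tDbl · (q ∸ p))) (num 0)).
  { assert (Z : eqv M (tDbl · (q ∸ p)) (num 0)) by (monus_split q p; lin).
    rewrite Z; apply pred_0. }
  destruct (@code_even _ M (tICode · p · q) (p ∸ q)) as [P N]; [lin|].
  monus_split p q; lin.
- monus_split p q; [|exfalso; lin]. monus_split q p; [exfalso; lin|].
  destruct (zero_or_suc M (q ∸ p)) as [Z|Z]; [exfalso; lin|].
  assert (P : eqv M (tPred · (tDbl · (q ∸ p))) (suc (tDbl · (tPred · (q ∸ p))))).
  { destruct (zero_or_suc M (tDbl · (q ∸ p))) as [Z'|Z']; [exfalso|]; lin. }
  destruct (@code_odd _ M (tICode · p · q) (tPred · (q ∸ p))) as [P' N]; lin.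
Qed.

Lemma dpos_dneg_cases G (M : mcs G) n :
  (eqv M n (num 0) /\ eqv M (tDPos · n) (num 0) /\ eqv M (tDNeg · n) (num 0)) \/
  (eqv M n (num 1) /\ eqv M (tDPos · n) (num 1) /\ eqv M (tDNeg · n) (num 0)) \/
  (le M (num 2) n /\ eqv M (tDPos · n) (num 0) /\ eqv M (tDNeg · n) (num 1)).
Proof.
pose proof (dpos_monus M n); pose proof (dneg_sg M n).
monus_split n (@num 1 G); monus_split n (tDbl · (n ∸ num 1));
  destruct (sg_cases M (n ∸ num 1)) as [[? ?]|[? ?]];
  try (exfalso; lin);
  destruct (le_total M (num 2) n); try (right; right; repeat split; lin);
  destruct (le_total M (num 1) n); try (right; left; repeat split; lin);
  left; repeat split; lin.
Qed.

(** Here P - Q is p(n+3) - q(n+3) - 8c, and the thresholds > 2 and < -2 for the digits 1 and -1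
    appear as gaps of 3. *)
Lemma digit_cases G (M : mcs G) p q n c :
  let P := p · suc (suc (suc n)) ⊕ t8 · (tINeg · c) in
  let Q := q · suc (suc (suc n)) ⊕ t8 · (tIPos · c) in
  let d := tDigit · p · q · n · c in
  (le M (Q ⊕ num 3) P /\ eqv M (tDPos · d) (num 1) /\ eqv M (tDNeg · d) (num 0)) \/
  (le M (P ⊕ num 3) Q /\ eqv M (tDPos · d) (num 0) /\ eqv M (tDNeg · d) (num 1)) \/
  (le M P (Q ⊕ num 2) /\ le M Q (P ⊕ num 2) /\
   eqv M (tDPos · d) (num 0) /\ eqv M (tDNeg · d) (num 0)).
Proof.
intros P Q d; pose proof (digit_sg M p q n c) as E.
fold P Q d in E; clearbody d P Q.
monus_split P (Q ⊕ num 2); monus_split Q (P ⊕ num 2);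
  destruct (sg_cases M (P ∸ (Q ⊕ num 2))) as [[? ?]|[? ?]]; try (exfalso; lin);
  destruct (sg_cases M (Q ∸ (P ⊕ num 2))) as [[? ?]|[? ?]]; try (exfalso; lin);
  destruct (dpos_dneg_cases M d) as [[? [? ?]]|[[? [? ?]]|[? [? ?]]]]; try (exfalso; lin);
  solve [left; repeat split; lin|right; left; repeat split; lin|right; right; repeat split; lin].
Qed.

(** * Partial sums, conversion to signed digits, and addition *)

Lemma pos_0 G (M : mcs G) g : eqv M (tPos · g · num 0) (tIPos · (g · num 0)).
Proof. rewrite pos_rec; apply eqv_ax, ax_rec0. Qed.

Lemma pos_S G (M : mcs G) g n :
  eqv M (tPos · g · suc n) (tDbl · (tPos · g · n) ⊕ tDPos · (g · suc n)).
Proof. rewrite !pos_rec; unfold rec at 1; rewrite rec_S; unfold_eqv. Qed.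

Lemma neg_0 G (M : mcs G) g : eqv M (tNeg · g · num 0) (tINeg · (g · num 0)).
Proof. rewrite neg_rec; apply eqv_ax, ax_rec0. Qed.

Lemma neg_S G (M : mcs G) g n :
  eqv M (tNeg · g · suc n) (tDbl · (tNeg · g · n) ⊕ tDNeg · (g · suc n)).
Proof. rewrite !neg_rec; unfold rec at 1; rewrite rec_S; unfold_eqv. Qed.

Lemma part_0 G (M : mcs G) p q :
  eqv M (tPart · p · q · num 0)
    (tICode · (tRound · (p · num 2 ∸ q · num 2)) · (tRound · (q · num 2 ∸ p · num 2))).
Proof. rewrite part_rec; apply eqv_ax, ax_rec0. Qed.

Lemma part_S G (M : mcs G) p q n :
  let c := tPart · p · q · n in
  eqv M (tPart · p · q · suc n)
    (tICode · (tDbl · (tIPos · c) ⊕ tDPos · (tDigit · p · q · n · c))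
            · (tDbl · (tINeg · c) ⊕ tDNeg · (tDigit · p · q · n · c))).
Proof.
intros c; unfold c; rewrite (part_rec M p q (suc n)), (part_rec M p q n).
unfold rec at 1; rewrite rec_S; unfold_eqv.
Qed.

Lemma conv_0 G (M : mcs G) p q : eqv M (tConv · p · q · num 0) (tPart · p · q · num 0).
Proof. rewrite conv_rec; apply eqv_ax, ax_rec0. Qed.

Lemma conv_S G (M : mcs G) p q n :
  eqv M (tConv · p · q · suc n) (tDigit · p · q · n · (tPart · p · q · n)).
Proof. rewrite conv_rec; unfold rec; rewrite rec_S; unfold_eqv. Qed.

(** The partial sums of the converted real and the integers c_n coded by [tPart] start alike and
    both satisfy c_(n+1) = 2 c_n + e with the same digit e. *)
Lemma conv_part G (M : mcs G) p q n :
  eqv M (tPos · (tConv · p · q) · n ⊕ tINeg · (tPart · p · q · n))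
        (tNeg · (tConv · p · q) · n ⊕ tIPos · (tPart · p · q · n)).
Proof.
apply mcs_Eq.
induct (tPos · (tConv · wk p · wk q) · v0 ⊕ tINeg · (tPart · wk p · wk q · v0) ≡
        tNeg · (tConv · wk p · wk q) · v0 ⊕ tIPos · (tPart · wk p · wk q · v0)) n.
- apply mcs_Eq; rewrite pos_0, neg_0, conv_0; apply plus_comm.
- intros IH; apply mcs_Eq in IH; apply mcs_Eq; rewrite pos_S, neg_S, conv_S, part_S.
  set (c := tPart · wk p · wk q · v0) in *.
  set (d := tDigit · wk p · wk q · v0 · c).
  pose proof (icode_spec M' (tDbl · (tIPos · c) ⊕ tDPos · d) (tDbl · (tINeg · c) ⊕ tDNeg · d)).
  lin.
Qed.

(** Halving n + 2 twice yields r with 4r <= n + 2 <= 4r + 3, that is, n/4 rounded to a nearest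
    integer. *)
Lemma round_bounds G (M : mcs G) n :
  let r := tRound · n in
  le M (tDbl · (tDbl · r)) (n ⊕ num 2) /\ le M n (tDbl · (tDbl · r) ⊕ num 1).
Proof.
intros r; pose proof (round_half M n) as E; fold r in E.
destruct (half_bounds M (n ⊕ num 2)); destruct (half_bounds M (tHalf · (n ⊕ num 2))).
split; lin.
Qed.

(* With [s n = p n - q n] the hypothesis is [s (n + 1) >= 2 (s n) - 2], and the
   conclusion [4 c_n <= s (n + 2) + 2], where [c_n] is the integer coded by
   [tPart p q n]. *)
Lemma part_upper G (M : mcs G) p q n :
  (M ⊨ All ty0 (leN (tDbl · (wk p · v0) ⊕ wk q · suc v0)
                    (wk p · suc v0 ⊕ tDbl · (wk q · v0) ⊕ num 2))) ->
  le M (tDbl · (tDbl · (tIPos · (tPart · p · q · n))) ⊕ q · suc (suc n))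
       (p · suc (suc n) ⊕ tDbl · (tDbl · (tINeg · (tPart · p · q · n))) ⊕ num 2).
Proof.
set (Hs := All ty0 _); intros K; apply mcs_leN.
eapply (mcs_ind_nf (H := [Hs]) (F :=
  leN (tDbl · (tDbl · (tIPos · (tPart · wk p · wk q · v0))) ⊕ wk q · suc (suc v0))
      (wk p · suc (suc v0) ⊕ tDbl · (tDbl · (tINeg · (tPart · wk p · wk q · v0))) ⊕ num 2)));
  [fsub_nf|fsub_nf|fsub_nf|intros ? [<-|[]]; exact K| |].
- apply mcs_leN; rewrite part_0.
  set (a := p · num 2); set (b := q · num 2).
  pose proof (icode_spec M (tRound · (a ∸ b)) (tRound · (b ∸ a))).
  destruct (round_bounds M (a ∸ b)), (round_bounds M (b ∸ a)).
  change (suc (suc (num 0))) with (@num 2 G); fold a b.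
  (* One of the two truncated differences is 0, and its rounding r satisfies only 4r <= 2. Splitting
     on r <= 0 supplies the integrality that rational certificates lack. *)
  destruct (le_total M (tRound · (a ∸ b)) (num 0)), (le_total M (tRound · (b ∸ a)) (num 0));
  monus_split a b; monus_split b a; lin.
- intros M' I IH; apply mcs_leN in IH; apply mcs_leN.
  specialize (I _ (or_introl eq_refl)).
  unfold Hs in I; fsub_nf in I.
  inst_nf I (suc (suc v0)) as J.
  apply mcs_leN in J; rewrite part_S.
  set (c := tPart · wk p · wk q · v0) in *.
  set (d := tDigit · wk p · wk q · v0 · c).
  pose proof (icode_spec M' (tDbl · (tIPos · c) ⊕ tDPos · d) (tDbl · (tINeg · c) ⊕ tDNeg · d)).
  pose proof (t8_dbl M' (tINeg · c)); pose proof (t8_dbl M' (tIPos · c)).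
  pose proof (digit_cases M' (wk p) (wk q) v0 c) as D; cbv zeta in D; fold d in D.
  (* For e = 1 and e = 0 the claim 8 c_n + 4e <= s(n+3) + 2 is the threshold of the digit itself.
     Only e = -1 needs the induction hypothesis: 8 c_n <= 2 s(n+2) + 4 <= s(n+3) + 6. *)
  destruct D as [[? [? ?]]|[[? [? ?]]|[? [? [? ?]]]]]; lin.
Qed.

Lemma mcs_leR G (M : mcs G) x y n : (M ⊨ x ≤R y) ->
  le M (tPos · x · n ⊕ tNeg · y · n) (tPos · y · n ⊕ tNeg · x · n ⊕ num 2).
Proof. unfold leR; intros K; apply mcs_leN; inst_nf K n as K'; exact K'. Qed.

Lemma mcs_eqR G (M : mcs G) x y n : (M ⊨ x =R y) ->
  le M (tPos · x · n ⊕ tNeg · y · n) (tPos · y · n ⊕ tNeg · x · n ⊕ num 2) /\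
  le M (tPos · y · n ⊕ tNeg · x · n) (tPos · x · n ⊕ tNeg · y · n ⊕ num 2).
Proof.
unfold eqR; intros K; rewrite <- !mcs_leN, <- mcs_And; inst_nf K n as K'; exact K'.
Qed.

Lemma nat_zero G (M : mcs G) n : eqv M (tNat · num 0 · n) (num 0).
Proof.
rewrite nat_cond; destruct (zero_or_suc M n) as [E|E].
- rewrite (cond_0 (M := M) _ _ E); lin.
- apply cond_S; lin.
Qed.

Lemma pos_zero G (M : mcs G) n : eqv M (tPos · (tNat · num 0) · n) (num 0).
Proof.
apply mcs_Eq; induct ((tPos · (tNat · num 0) · v0 ≡ num 0) : fm (ty0 :: G)) n.
- apply mcs_Eq; rewrite pos_0, nat_zero.
  destruct (@code_even _ M (num 0) (num 0)); lin.
- intros IH; apply mcs_Eq in IH; apply mcs_Eq; rewrite pos_S, nat_zero.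
  destruct (dpos_dneg_cases M' (num 0)) as [[? [? ?]]|[[? [? ?]]|[? [? ?]]]]; lin.
Qed.

Lemma neg_zero G (M : mcs G) n : eqv M (tNeg · (tNat · num 0) · n) (num 0).
Proof.
apply mcs_Eq; induct ((tNeg · (tNat · num 0) · v0 ≡ num 0) : fm (ty0 :: G)) n.
- apply mcs_Eq; rewrite neg_0, nat_zero.
  destruct (@code_even _ M (num 0) (num 0)); lin.
- intros IH; apply mcs_Eq in IH; apply mcs_Eq; rewrite neg_S, nat_zero.
  destruct (dpos_dneg_cases M' (num 0)) as [[? [? ?]]|[[? [? ?]]|[? [? ?]]]]; lin.
Qed.

(** Every function of type 1 qualifies: all codes from 2 on count as the digit -1, so z_(n+1) - 2
    z_n is always -1, 0 or 1. *)
Lemma partial_sum_step G (M : mcs G) g n :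
  le M (tDbl · (tPos · g · n) ⊕ tNeg · g · suc n)
       (tPos · g · suc n ⊕ tDbl · (tNeg · g · n) ⊕ num 1) /\
  le M (tPos · g · suc n ⊕ tDbl · (tNeg · g · n))
       (tDbl · (tPos · g · n) ⊕ tNeg · g · suc n ⊕ num 1).
Proof.
pose proof (pos_S M g n); pose proof (neg_S M g n).
destruct (dpos_dneg_cases M (g · suc n)) as [[? [? ?]]|[[? [? ?]]|[? [? ?]]]]; split; lin.
Qed.

(* [4 (x + y)_n <= x_(n+2) + y_(n+2) + 2], where [z_n] is the integer
   [tPos z n - tNeg z n]. *)
Lemma addR_upper G (M : mcs G) x y n :
  le M (tDbl · (tDbl · (tPos · (x +R y) · n))
          ⊕ (tNeg · x · suc (suc n) ⊕ tNeg · y · suc (suc n)))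
       (tPos · x · suc (suc n) ⊕ tPos · y · suc (suc n)
          ⊕ tDbl · (tDbl · (tNeg · (x +R y) · n)) ⊕ num 2).
Proof.
set (p := λ ty0, tPos · wk x · v0 ⊕ tPos · wk y · v0).
set (q := λ ty0, tNeg · wk x · v0 ⊕ tNeg · wk y · v0).
assert (A : eqv M (x +R y) (tConv · p · q)) by apply addR_conv.
assert (P : forall k, eqv M (p · k) (tPos · x · k ⊕ tPos · y · k))
  by (intros k; unfold p; unfold_eqv).
assert (Q : forall k, eqv M (q · k) (tNeg · x · k ⊕ tNeg · y · k))
  by (intros k; unfold q; unfold_eqv).
pose proof (conv_part M p q n) as C.
assert (L : le M (tDbl · (tDbl · (tIPos · (tPart · p · q · n))) ⊕ q · suc (suc n))
       (p · suc (suc n) ⊕ tDbl · (tDbl · (tINeg · (tPart · p · q · n))) ⊕ num 2)).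
{ apply part_upper, (mcs_AllI (H := [])); [intros ? []|].
  intros M' _; apply mcs_leN.
  assert (P' : forall k, eqv M' (wk p · k) (tPos · wk x · k ⊕ tPos · wk y · k)).
  { intros k.
    assert (E : wk (B := ty0) p = λ ty0, tPos · wk (wk x) · v0 ⊕ tPos · wk (wk y) · v0)
      by (rewrite <- (tsub_shift ty0 p); unfold p; tsub_nf).
    rewrite E; unfold_eqv. }
  assert (Q' : forall k, eqv M' (wk q · k) (tNeg · wk x · k ⊕ tNeg · wk y · k)).
  { intros k.
    assert (E : wk (B := ty0) q = λ ty0, tNeg · wk (wk x) · v0 ⊕ tNeg · wk (wk y) · v0)
      by (rewrite <- (tsub_shift ty0 q); unfold q; tsub_nf).
    rewrite E; unfold_eqv. }
  rewrite !P', !Q'.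
  (* Each summand loses at most 1 per step, which gives the 2 in the hypothesis of [part_upper]. *)
  destruct (partial_sum_step M' (wk x) v0), (partial_sum_step M' (wk y) v0); lin. }
rewrite P, Q in L; rewrite A; lin.
Qed.

(* The axioms imply nonnegativity only through the triangle inequality:
   [0 = d(x,x) <= d(x,y) + d(y,x)]. If [d(x,y)_n <= -3], then
   [d(x,y)_(n+3) <= -17] and [d(y,x)_(n+3) <= -15], so the (n+1)-st approximation
   of the sum is at most -8, while that of 0 differs from it by at most 4. *)
Lemma dist_nonneg G (M : mcs G) x y n :
  le M (tNeg · dist x y · n) (tPos · dist x y · n ⊕ num 2).
Proof.
set (m := suc (suc (suc n))).
assert (R : M ⊨ dist x x =R tNat · num 0) by apply mcs_ax, ax_dist_refl.
assert (S : M ⊨ dist x y =R dist y x) by apply mcs_ax, ax_dist_sym.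
assert (T : M ⊨ dist x x ≤R dist x y +R dist y x) by apply mcs_ax, ax_dist_triangle.
destruct (mcs_eqR (suc n) R) as [_ R'].
destruct (mcs_eqR m S) as [_ S'].
pose proof (mcs_leR (suc n) T) as T'.
pose proof (addR_upper M (dist x y) (dist y x) (suc n)) as U; fold m in U.
pose proof (pos_zero M (suc n)); pose proof (neg_zero M (suc n)).
destruct (partial_sum_step M (dist x y) n) as [_ ?].
destruct (partial_sum_step M (dist x y) (suc n)) as [_ ?].
destruct (partial_sum_step M (dist x y) (suc (suc n))) as [_ L]; fold m in L.
clear R S T; lin.
Qed.

(** * Powers of two and the reals 1/(r+1) *)

Definition tPow {G} : tm G (ty0 ⇒ ty0) := λ ty0, rec v0 (num 1) (λ ty0, λ ty0, tDbl · v1).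

Lemma tsub_tPow G D (s : sub G D) : tsub s tPow = tPow.
Proof. unfold tPow, rec; tsub_nf. Qed.
#[export] Hint Extern 1 (tsub _ tPow = _) => apply tsub_tPow : tsub_db.

Lemma pow_rec G (M : mcs G) n : eqv M (tPow · n) (rec n (num 1) (λ ty0, λ ty0, tDbl · v1)).
Proof. unfold tPow; unfold_eqv. Qed.
#[global] Opaque tPow.

Lemma pow_0 G (M : mcs G) : eqv M (tPow · num 0) (num 1).
Proof. rewrite pow_rec; apply eqv_ax, ax_rec0. Qed.

Lemma pow_S G (M : mcs G) n : eqv M (tPow · suc n) (tDbl · (tPow · n)).
Proof. rewrite !pow_rec; unfold rec at 1; rewrite rec_S; unfold_eqv. Qed.

Lemma pow_le G (M : mcs G) m n : le M m n -> le M (tPow · m) (tPow · n).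
Proof.
intros L; rewrite (le_monus L); generalize (n ∸ m); intros k; apply mcs_leN.
induct (leN (tPow · wk m) (tPow · (wk m ⊕ v0))) k; rewrite !mcs_leN.
- rewrite plus_0r; apply le_refl.
- intros IH; pose proof (pow_S M' (wk m ⊕ v0)); rewrite plus_Sr; lin.
Qed.

Lemma rem_0 G (M : mcs G) k : eqv M (tRem · k · num 0) (tSg · k).
Proof. rewrite rem_rec; apply eqv_ax, ax_rec0. Qed.

Lemma rem_S G (M : mcs G) k n :
  let r := tDbl · (tRem · k · n) in
  eqv M (tRem · k · suc n) (tCond · (r ∸ k) · r · (r ∸ suc k)).
Proof.
intros r; unfold r; rewrite (rem_rec M k (suc n)), (rem_rec M k n); unfold rec at 1.
rewrite rec_S; unfold_eqv.
Qed.

Lemma inv_0 G (M : mcs G) k : eqv M (tInv · k · num 0) (tDbl · (num 1 ∸ k)).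
Proof. rewrite inv_rec; apply eqv_ax, ax_rec0. Qed.

Lemma inv_S G (M : mcs G) k n :
  eqv M (tInv · k · suc n) (tSg · (tDbl · (tRem · k · n) ∸ k)).
Proof. rewrite inv_rec; unfold rec; rewrite rec_S; unfold_eqv. Qed.

(** If 2^n <= r then 1/(r+1) < 2^(-n): long division has not yet subtracted r + 1, so the remainder
    is still 2^n and every digit so far is 0. The hypothesis depends on [n], so the induction runs
    over the implication. *)
Lemma pos_inv G (M : mcs G) r n : le M (tPow · n) r ->
  eqv M (tRem · r · n) (tPow · n) /\ eqv M (tPos · (tInv · r) · n) (num 0).
Proof.
rewrite <- mcs_leN, <- !mcs_Eq, <- mcs_And, <- mcs_Imp.
induct (leN (tPow · v0) (wk r) ⟶
  (tRem · wk r · v0 ≡ tPow · v0 ⊓ tPos · (tInv · wk r) · v0 ≡ num 0)) n;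
  rewrite !mcs_Imp, !mcs_And, !mcs_leN.
- rewrite !mcs_Eq; intros L; rewrite rem_0, pos_0, inv_0.
  pose proof (pow_0 M); split.
  + destruct (sg_cases M r) as [[? ?]|[? ?]]; lin.
  + destruct (@code_even _ M (tDbl · (num 1 ∸ r)) (num 1 ∸ r)); [reflexivity|].
    monus_split (@num 1 G) r; lin.
- rewrite !mcs_Eq; intros IH L.
  pose proof (pow_S M' v0) as P; destruct IH as [IH1 IH2]; [lin|].
  assert (Z : eqv M' (tDbl · (tRem · wk r · v0) ∸ wk r) (num 0)).
  { change (le M' (tDbl · (tRem · wk r · v0)) (wk r)); lin. }
  split.
  + rewrite rem_S, (cond_0 _ _ Z); lin.
  + rewrite pos_S, inv_S.
    destruct (sg_cases M' (tDbl · (tRem · wk r · v0) ∸ wk r)) as [[? ?]|[? ?]]; [|exfalso; lin].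
    destruct (dpos_dneg_cases M' (tSg · (tDbl · (tRem · wk r · v0) ∸ wk r)))
      as [[? [? ?]]|[[? [? ?]]|[? [? ?]]]]; lin.
Qed.

(** * Collection *)

Lemma mcs_ExE G (M : mcs G) H A (F : fm (A :: G)) C :
  (forall B, In B H -> M ⊨ B) -> (M ⊨ Ex A F) ->
  (forall M', (forall B, In B H -> M' ⊨ fwk B) -> (M' ⊨ F) -> (M' ⊨ fwk C)) ->
  (M ⊨ C).
Proof.
intros I K V; apply (mcs_closed (H := Ex A F :: H)).
- intros B [<-|J]; auto.
- apply (pf_ExE (F := F)); [apply pf_hyp; now left|].
  apply prov_mcs; intros M' I'; apply V; [|apply I'; now left].
  intros B J; apply I'; right; right; now apply in_map.
Qed.

(** If no instance of [P ⟶ Q] held, every instance of [P] would hold and none of [Q], against the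
    assumption. One variable thus serves both as index of the premise and as witness of the
    conclusion. *)
Lemma mcs_prenex G (M : mcs G) A (P Q : fm (A :: G)) :
  ((M ⊨ All A P) -> (M ⊨ Ex A Q)) -> (M ⊨ Ex A (P ⟶ Q)).
Proof.
intros K; destruct (mcs_complete M (Ex A (P ⟶ Q))) as [J|J]; [exact J|].
assert (V : forall M', (forall B, In B [¬ Ex A (P ⟶ Q)] -> M' ⊨ fwk B) -> ~ (M' ⊨ P ⟶ Q)).
{ intros M' I L; specialize (I _ (or_introl eq_refl)).
  (* Instantiating the weakened existential formula at the new variable gives back its own
     matrix. *)
  assert (E : M' ⊨ (fsub (P ⟶ Q) (up (@shift G A)))⟨v0⟩).
  { rewrite fsub_up_shift_inst; exact L. }
  exact (proj1 (mcs_Not M' _) I (mcs_ExI E)). }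
exfalso; apply (mcs_consistent (m := M)).
apply (mcs_ExE (H := [¬ Ex A (P ⟶ Q)]) (F := Q)); [intros B [<-|[]]; exact J| |].
- apply K, (mcs_AllI (H := [¬ Ex A (P ⟶ Q)])); [intros B [<-|[]]; exact J|].
  intros M' I; apply NNPP; intros N; apply (V M' I), mcs_Imp; tauto.
- intros M' I L; exfalso; apply (V M' I), mcs_Imp; auto.
Qed.

Lemma eqR_intro G (M : mcs G) x y x' y' :
  wk x = x' -> wk y = y' -> (M ⊨ All ty0 (eqR_at x' y' v0)) -> (M ⊨ x =R y).
Proof. intros <- <- K; exact K. Qed.

Lemma ltR_elim G (M : mcs G) x y x' y' :
  (M ⊨ x <R y) -> wk x = x' -> wk y = y' -> (M ⊨ Ex ty0 (ltR_at x' y' v0)).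
Proof. intros K <- <-; exact K. Qed.

Lemma ltR_intro G (M : mcs G) x y n : (M ⊨ ltR_at x y n) -> (M ⊨ x <R y).
Proof.
intros K; change (M ⊨ Ex ty0 (ltR_at (wk x) (wk y) v0)).
apply (mcs_ExI (t := n)); rewrite (fsub_ltR_at_eq (tsub_inst_wk _ _) (tsub_inst_wk _ _) eq_refl).
exact K.
Qed.

(** The upper half is the instance of [≤R] at index n: since 2^n <= 2^m, the positive part of the
    right-hand side is 0 there, and its negative part is a natural number. The lower half is
    [dist_nonneg]. *)
Lemma dist_small G (M : mcs G) x y m n :
  (M ⊨ dist x y ≤R tInv · (tPow · m)) -> (M ⊨ leN n m) ->
  (M ⊨ eqR_at (dist x y) (tNat · num 0) n).
Proof.
rewrite mcs_leN; intros D L; apply mcs_And; split; apply mcs_leN;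
  rewrite pos_zero, neg_zero.
- pose proof (mcs_leR n D); destruct (pos_inv (pow_le L)); lin.
- pose proof (dist_nonneg M x y n); lin.
Qed.

(** Crossing a quantifier discards the old maximal consistent set, and with it every fact not
    explicitly carried over. The main proof carries at most two formulas at a time, listed with
    their weakened forms. *)
Lemma mcs_ExE2 G (M : mcs G) F1 F2 A (F : fm (A :: G)) C F1' F2' C' :
  (M ⊨ F1) -> (M ⊨ F2) -> (M ⊨ Ex A F) ->
  fwk F1 = F1' -> fwk F2 = F2' -> fwk C = C' ->
  (forall M', (M' ⊨ F1') -> (M' ⊨ F2') -> (M' ⊨ F) -> (M' ⊨ C')) -> (M ⊨ C).
Proof.
intros K1 K2 K <- <- <- V; apply (mcs_ExE (H := [F1; F2]) (F := F)); [|exact K|].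
- intros B [<-|[<-|[]]]; assumption.
- intros M' I; apply V; apply I; [left|right; left]; reflexivity.
Qed.

Lemma mcs_AllI2 G (M : mcs G) F1 F2 A (F : fm (A :: G)) F1' F2' :
  (M ⊨ F1) -> (M ⊨ F2) -> fwk F1 = F1' -> fwk F2 = F2' ->
  (forall M', (M' ⊨ F1') -> (M' ⊨ F2') -> (M' ⊨ F)) -> (M ⊨ All A F).
Proof.
intros K1 K2 <- <- V; apply (mcs_AllI (H := [F1; F2])).
- intros B [<-|[<-|[]]]; assumption.
- intros M' I; apply V; apply I; [left|right; left]; reflexivity.
Qed.

Lemma mcs_ExI_nf G (M : mcs G) A (F : fm (A :: G)) t F' :
  F⟨t⟩ = F' -> (M ⊨ F') -> (M ⊨ Ex A F).
Proof. intros <-; apply mcs_ExI. Qed.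

Tactic Notation "ex_elim" ident(M) ident(K) "keeping" ident(K1) ident(K2) :=
  eapply (mcs_ExE2 K1 K2 K);
  [fsub_nf|fsub_nf|fsub_nf|clear; intros M K1 K2 K].

Tactic Notation "all_intro" ident(M) "keeping" ident(K1) ident(K2) :=
  eapply (mcs_AllI2 K1 K2); [fsub_nf|fsub_nf|clear; intros M K1 K2].

Tactic Notation "ex_elim" ident(M) ident(K) "keeping" ident(K1) :=
  eapply (mcs_ExE2 K1 K1 K); [fsub_nf|fsub_nf|fsub_nf|clear; intros M _ K1 K].

Tactic Notation "all_intro" ident(M) "keeping" ident(K1) :=
  eapply (mcs_AllI2 K1 K1); [fsub_nf|fsub_nf|clear; intros M _ K1].

Tactic Notation "witness" uconstr(t) := eapply (mcs_ExI_nf (t := t)); [fsub_nf|].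

Notation v6 := (Var (vs (vs (vs (vs (vs (vs vz))))))).
Notation v7 := (Var (vs (vs (vs (vs (vs (vs (vs vz)))))))).

Theorem proposition4p2 :
  T_Mplus ⊢
  (* ∀ U φ u *)
  All (tyX ⇒ tyX) (All (tyX ⇒ tyX ⇒ ty1) (All (ty0 ⇒ tyX) (
    (* ∀ r ∃ n ∀ m ≥ n, d(U(u_m), u_m) ≤ 1/(r+1);
       m, n, r, u, φ, U are v0, ..., v5 *)
    All ty0 (Ex ty0 (All ty0 (leN v1 v0 ⟶
      dist (v5 · (v3 · v0)) (v3 · v0) ≤R tInv · v2)))
    ⟶
    (* ∀ k ∃ x ∈ F ∀ y ∈ F, φ(x,x) < φ(x,y) + 1/(k+1);
       y, x, k, u, φ, U are v0, ..., v5 *)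
    All ty0 (Ex tyX (isFix v4 v0 ⊓ All tyX (isFix v5 v0 ⟶
      v4 · v1 · v1 <R v4 · v1 · v0 +R tInv · v2)))
    ⟶
    (* ∀ k ∃ x ∈ F ∃ n ∀ m ≥ n, φ(x,x) < φ(x,u_m) + 1/(k+1);
       m, n, x, k, u, φ are v0, ..., v5 *)
    All ty0 (Ex tyX (isFix v4 v0 ⊓ Ex ty0 (All ty0 (leN v1 v0 ⟶
      v5 · v2 · v2 <R v5 · v2 · (v4 · v0) +R tInv · v3))))))).
Proof.
apply pf_AllI, pf_AllI, pf_AllI, prov_mcs; intros M _.
unfold isFix; cbn [eqt].
apply mcs_Imp; intros Hu; apply mcs_Imp; intros Hx.
all_intro M keeping Hu Hx.
inst_nf Hx v0 as K.
ex_elim M K keeping Hu.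
apply mcs_And in K as [Fix K].
witness v0.
apply mcs_And; split; [exact Fix|].
(* The outer quantifier is a dummy, as collection is stated for Sigma-formulas. *)
set (B := Ex ty0 (eqR_at (dist (v7 · v2) v2) (tNat · num 0) v1
                  ⟶ ltR_at (v6 · v3 · v3) (v6 · v3 · v2 +R tInv · v4) v1)
        : fm [ty0; tyX; tyX; ty0; ty0 ⇒ tyX; tyX ⇒ tyX ⇒ ty1; tyX ⇒ tyX]).
assert (Col : M ⊨ All tyX (Ex ty0 B)).
{ all_intro M keeping K.
  inst_nf K v0 as L.
  rewrite mcs_Imp in L.
  assert (J : M ⊨ Ex ty0 (eqR_at (dist (v6 · v1) v1) (tNat · num 0) v0
                          ⟶ ltR_at (v5 · v2 · v2) (v5 · v2 · v1 +R tInv · v3) v0)).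
  { apply mcs_prenex; intros P; eapply ltR_elim; [apply L|tsub_nf|tsub_nf].
    eapply eqR_intro; [tsub_nf|tsub_nf|exact P]. }
  unfold B; ex_elim M J keeping K.
  witness v0.
  (* An arbitrary value for the dummy quantifier. *)
  witness (num 0).
  exact J. }
assert (Ax : M ⊨ All tyX (Ex ty0 B) ⟶ Ex ty0 (All tyX (ExLe v1 (fsub B (shift2 ty0))))).
{ apply mcs_prov, pf_ax, ax_collection_X; constructor; unfold B, eqR_at, leR_at, ltR_at, ltN, leN.
  repeat constructor. }
rewrite mcs_Imp in Ax; specialize (Ax Col); clear Col; unfold B in Ax.
ex_elim M Ax keeping Hu.
inst_nf Hu (tPow · v0) as L.
ex_elim M L keeping Ax.
witness v0.
all_intro M keeping Ax L.
apply mcs_Imp; intros Lm.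
inst_nf L v0 as D.
rewrite mcs_Imp in D; specialize (D Lm); clear L Lm.
inst_nf Ax (v5 · v0) as K.
ex_elim M K keeping D.
apply mcs_And in K as [Ln K].
ex_elim M K keeping D Ln.
(* The index n <= N found for y = u_m verifies the premise by [dist_small] and then witnesses the
   strict inequality. *)
rewrite mcs_Imp in K; exact (ltR_intro (K (dist_small D Ln))).
Qed.
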